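(* Let $(R,\mathfrak m)$ be a one-dimensional Cohen-Macaulay local ring with canonical module. The following statements are equivalent. (i) $R$ has a canonical reduction. (ii) $R\ltimes R$ has a canonical reduction. (iii) $R\ltimes\mathfrak m$ has a canonical reduction.
   Context: For an $R$-module $M$, $R\ltimes M$ is the idealization of $M$ over $R$: the additive group $R\oplus M$ with multiplication $(r,m)(r',m')=(rr',rm'+r'm)$; it is a local ring with maximal ideal $\mathfrak m\times M$. A canonical ideal of a Cohen-Macaulay local ring is an ideal isomorphic to a canonical module. An ideal $J\subseteq I$ is a reduction of $I$ if $I^{n+1}=JI^n$ for some $n$. A canonical reduction of a one-dimensional Cohen-Macaulay local ring is a canonical ideal that is a reduction of the maximal ideal. *)

(* Defs.v *)
From HB Require Import structures.
From mathcomp Require Import all_boot all_algebra.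
From mathcomp Require Import boolp classical_sets.

Set Implicit Arguments.
Unset Strict Implicit.
Unset Printing Implicit Defensive.

Import GRing.Theory.
Local Open Scope classical_set_scope.
Local Open Scope ring_scope.

(** * Local rings and the residue field *)

(* A comUnitRingType is nonzero, so it is local iff its nonunits are closed
   under addition; the nonunits then form the maximal ideal. *)
HB.mixin Record isLocalRing R of GRing.ComUnitRing R := {
  nonunitD : forall x y : R,
    x \isn't a GRing.unit -> y \isn't a GRing.unit ->
    x + y \isn't a GRing.unit
}.

#[short(type="localRingType")]
HB.structure Definition LocalRing := {R of GRing.ComUnitRing R & isLocalRing R}.

Definition maxideal (R : localRingType) : pred R :=
  fun x => x \isn't a GRing.unit.

Lemma maxideal_idealr_closed (R : localRingType) : idealr_closed (@maxideal R).
Proof.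
have mE x : (x \in @maxideal R) = (x \isn't a GRing.unit) by [].
split; rewrite ?mE ?unitr0 ?unitr1 // => a x y; rewrite !mE => xm ym.
by apply: nonunitD => //; rewrite unitrM negb_and xm orbT.
Qed.

HB.instance Definition _ (R : localRingType) :=
  isIdealr.Build R (@maxideal R) (@maxideal_idealr_closed R).

(* The same predicate, registered as a submodule of the regular module. *)
Definition maxsubmod (R : localRingType) : pred R^o := @maxideal R.

Lemma maxsubmod_closed (R : localRingType) : submod_closed (@maxsubmod R).
Proof.
by have [m0 _ mD] := @maxideal_idealr_closed R; split=> // a u v; apply: mD.
Qed.

HB.instance Definition _ (R : localRingType) :=
  GRing.isSubmodClosed.Build R R^o (@maxsubmod R) (@maxsubmod_closed R).

Record maxmodule (R : localRingType) : predArgType :=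
  MaxModule { maxval : R^o; _ : maxval \in @maxsubmod R }.

HB.instance Definition _ (R : localRingType) := [isSub for @maxval R].
HB.instance Definition _ (R : localRingType) :=
  [Choice of maxmodule R by <:].
HB.instance Definition _ (R : localRingType) :=
  [SubChoice_isSubLmodule of maxmodule R by <:].

Definition residue_field (R : localRingType) : Type :=
  {ideal_quot (@maxideal R : idealr R)}.

HB.instance Definition _ (R : localRingType) :=
  GRing.ComNzRing.on (residue_field R).

Section ResidueFieldModule.
Variable R : localRingType.

Definition residue (a : R) : residue_field R :=
  (\pi_({ideal_quot (@maxideal R : idealr R)}) a)%qT.

Lemma residueD : {morph residue : a b / a + b}.
Proof. exact: rmorphD. Qed.

Lemma residueM : {morph residue : a b / a * b}.
Proof. exact: rmorphM. Qed.

Lemma residue1 : residue 1 = 1.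
Proof. exact: rmorph1. Qed.

Definition residue_scale (a : R) (x : residue_field R) := residue a * x.

Lemma residue_scaleA a b x :
  residue_scale a (residue_scale b x) = residue_scale (a * b) x.
Proof. by rewrite /residue_scale residueM mulrA. Qed.

Lemma residue_scale1 : left_id 1 residue_scale.
Proof. by move=> x; rewrite /residue_scale residue1 mul1r. Qed.

Lemma residue_scaleDr : right_distributive residue_scale +%R.
Proof. by move=> a x y; rewrite /residue_scale mulrDr. Qed.

Lemma residue_scaleDl x : {morph residue_scale^~ x : a b / a + b}.
Proof. by move=> a b; rewrite /residue_scale residueD mulrDl. Qed.

HB.instance Definition _ := GRing.Zmodule_isLmodule.Build R (residue_field R)
  residue_scaleA residue_scale1 residue_scaleDr residue_scaleDl.

End ResidueFieldModule.

(** * Idealization *)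

Definition idealization (R : comUnitRingType) (M : lmodType R) : Type :=
  (R * M)%type.

Section Idealization.
Variables (R : comUnitRingType) (M : lmodType R).
Local Notation S := (idealization M).

HB.instance Definition _ := GRing.Zmodule.copy S (R * M)%type.

Definition idealization_one : S := (1, 0).

Definition idealization_mul (x y : S) : S :=
  (x.1 * y.1, x.1 *: y.2 + y.1 *: x.2).

Lemma idealization_mulA : associative idealization_mul.
Proof.
move=> [a m] [b n] [c p]; congr (_, _) => /=; first by rewrite mulrA.
by rewrite !scalerDr !scalerA addrA (mulrC c a) (mulrC c b).
Qed.

Lemma idealization_mulC : commutative idealization_mul.
Proof. by move=> x y; congr (_, _); [rewrite mulrC | rewrite addrC]. Qed.

Lemma idealization_mul1 : left_id idealization_one idealization_mul.
Proof. by move=> [a m]; rewrite /idealization_mul /= mul1r scale1r scaler0 addr0. Qed.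

Lemma idealization_mulDl : left_distributive idealization_mul +%R.
Proof.
move=> [a m] [b n] [c p]; congr (_, _) => /=; first by rewrite mulrDl.
by rewrite scalerDl scalerDr addrACA.
Qed.

Lemma idealization_one_neq0 : idealization_one != 0.
Proof. by apply/eqP => -[/eqP]; rewrite oner_eq0. Qed.

HB.instance Definition _ := GRing.Zmodule_isComNzRing.Build S
  idealization_mulA idealization_mulC idealization_mul1 idealization_mulDl
  idealization_one_neq0.

Definition idealization_unit : pred S := fun x => x.1 \is a GRing.unit.

Definition idealization_inv (x : S) : S :=
  if idealization_unit x then (x.1^-1, - (x.1^-1 ^+ 2 *: x.2)) else x.

Lemma idealization_mulVx :
  {in idealization_unit, left_inverse 1 idealization_inv *%R}.
Proof.
move=> [a m] /[dup] aU; rewrite unfold_in /idealization_unit /= => aU'.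
rewrite /idealization_inv /idealization_unit /= aU'; congr (_, _) => /=.
  by rewrite mulVr.
by rewrite scalerN scalerA expr2 mulrA divrr // mul1r subrr.
Qed.

Lemma idealization_unitPl (x y : S) : y * x = 1 -> idealization_unit x.
Proof. by case=> yx1 _; apply/unitrPr; exists y.1; rewrite mulrC. Qed.

Lemma idealization_invx0 :
  {in [predC idealization_unit], idealization_inv =1 id}.
Proof.
by move=> x xU; rewrite /idealization_inv ifN.
Qed.

HB.instance Definition _ := GRing.ComNzRing_hasMulInverse.Build S
  idealization_mulVx idealization_unitPl idealization_invx0.

Lemma idealization_unitE (x : S) :
  (x \is a GRing.unit) = (x.1 \is a GRing.unit).
Proof. by []. Qed.

End Idealization.

Section IdealizationLocal.
Variables (R : localRingType) (M : lmodType R).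

Lemma idealization_nonunitD (x y : idealization M) :
  x \isn't a GRing.unit -> y \isn't a GRing.unit -> x + y \isn't a GRing.unit.
Proof. by rewrite !idealization_unitE; apply: nonunitD. Qed.

HB.instance Definition _ :=
  isLocalRing.Build (idealization M) idealization_nonunitD.

Lemma maxideal_idealization (x : idealization M) :
  (x \in @maxideal (idealization M)) = (x.1 \in @maxideal R).
Proof. by []. Qed.

End IdealizationLocal.

(** * Ideals, dimension and depth *)

Section Ideals.
Variable R : comUnitRingType.
Implicit Types I J P : set R.

Definition is_ideal I : Prop :=
  I 0 /\ forall a x y, I x -> I y -> I (a * x + y).

Definition is_prime_ideal P : Prop :=
  [/\ is_ideal P, ~ P 1 & forall x y, P (x * y) -> P x \/ P y].

Definition ideal_gen n (g : 'I_n -> R) : set R :=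
  [set x | exists a : 'I_n -> R, x = \sum_i a i * g i].

Definition noetherian : Prop :=
  forall I, is_ideal I -> exists n (g : 'I_n -> R), I = ideal_gen g.

Definition ideal_mul I J : set R :=
  [set x | exists n (a b : 'I_n -> R),
    (forall i, I (a i) /\ J (b i)) /\ x = \sum_i a i * b i].

Definition ideal_exp I n : set R := iter n (ideal_mul I) setT.

Definition is_reduction J I : Prop :=
  J `<=` I /\ exists n, ideal_exp I n.+1 = ideal_mul J (ideal_exp I n).

Definition prime_chain n : Prop :=
  exists P : nat -> set R,
    (forall i, (i <= n)%N -> is_prime_ideal (P i)) /\
    (forall i, (i < n)%N -> P i `<` P i.+1).

Definition has_krull_dim n : Prop := prime_chain n /\ ~ prime_chain n.+1.

End Ideals.

Section Depth.
Variable R : localRingType.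
Implicit Types (M : lmodType R) (rs : seq R).

Definition fin_gen M : Prop :=
  exists n (g : 'I_n -> M), forall x, exists a : 'I_n -> R,
    x = \sum_i a i *: g i.

(* The submodule (r_1, ..., r_n)M. *)
Definition seq_submod M rs : set M :=
  [set x | exists y : 'I_(size rs) -> M, x = \sum_(i < size rs) rs`_i *: y i].
Arguments seq_submod : clear implicits.

Definition regular_seq M rs : Prop :=
  [/\ forall i, (i < size rs)%N -> rs`_i \in @maxideal R,
      forall i x, (i < size rs)%N ->
        seq_submod M (take i rs) (rs`_i *: x) -> seq_submod M (take i rs) x
    & exists x, ~ seq_submod M rs x].

Definition has_depth M n : Prop :=
  (exists rs, size rs = n /\ regular_seq M rs) /\
  ~ (exists rs, size rs = n.+1 /\ regular_seq M rs).

Definition maximal_CM M : Prop :=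
  fin_gen M /\ exists d, has_krull_dim R d /\ has_depth M d.

End Depth.

Definition cohen_macaulay (R : localRingType) : Prop :=
  noetherian R /\ exists d, has_krull_dim R d /\ has_depth R^o d.

(** * Injective resolutions and Ext *)

Section Homological.
Variable R : comUnitRingType.

Definition injective_module (E : lmodType R) : Prop :=
  forall (A B : lmodType R) (f : {linear A -> B}) (g : {linear A -> E}),
    injective f -> exists h : {linear B -> E}, forall x, h (f x) = g x.

Definition injective_resolution (M : lmodType R) (I : nat -> lmodType R)
    (eta : {linear M -> I 0%N}) (d : forall n, {linear I n -> I n.+1}) : Prop :=
  [/\ forall n, injective_module (I n),
      injective eta,
      forall y, d 0%N y = 0 <-> exists x, eta x = y
    & forall n y, d n.+1 y = 0 <-> exists x, d n x = y].

Definition finite_injdim (M : lmodType R) : Prop :=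
  exists I eta d, @injective_resolution M I eta d /\
    exists n, forall i, (n < i)%N -> forall x : I i, x = 0.

Section Cochains.
Variables (N : lmodType R) (I : nat -> lmodType R).
Variable d : forall n, {linear I n -> I n.+1}.

Definition cocycle n (f : {linear N -> I n}) : Prop :=
  forall x, d n (f x) = 0.

Definition coboundary n : {linear N -> I n} -> Prop :=
  match n with
  | 0%N => fun f => forall x, f x = 0
  | m.+1 => fun f => exists g : {linear N -> I m}, forall x, f x = d m (g x)
  end.

End Cochains.

(* E is isomorphic to Ext^n_R(N, M), the n-th cohomology of Hom_R(N, I) for an
   injective resolution I of M: cl induces a linear bijection from cocycles
   modulo coboundaries onto E.  The values of cl off cocycles are irrelevant. *)
Definition is_Ext (N M : lmodType R) (n : nat) (E : lmodType R) : Prop :=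
  exists I eta d, @injective_resolution M I eta d /\
    exists cl : {linear N -> I n} -> E,
      [/\ forall a (f g h : {linear N -> I n}), cocycle d f -> cocycle d g ->
            (forall x, h x = a *: f x + g x) -> cl h = a *: cl f + cl g,
          forall e, exists2 f : {linear N -> I n}, cocycle d f & cl f = e
        & forall f : {linear N -> I n}, cocycle d f -> cl f = 0 <-> coboundary d f].

End Homological.

(** * Canonical modules and canonical reductions *)

Section Canonical.
Variable R : localRingType.

(* E is a vector space of dimension r over the residue field: it is killed by
   the maximal ideal, and e is a basis, its coefficients being taken in R and
   considered modulo the maximal ideal. *)
Definition has_residue_dim (E : lmodType R) (r : nat) : Prop :=
  (forall a (x : E), a \in @maxideal R -> a *: x = 0) /\
  exists e : 'I_r -> E,
    (forall x, exists a : 'I_r -> R, x = \sum_i a i *: e i) /\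
    (forall a : 'I_r -> R, \sum_i a i *: e i = 0 ->
       forall i, a i \in @maxideal R).

Definition has_type (M : lmodType R) (r : nat) : Prop :=
  exists t (E : lmodType R),
    [/\ has_depth M t, is_Ext (residue_field R) M t E & has_residue_dim E r].

Definition canonical_module (C : lmodType R) : Prop :=
  [/\ maximal_CM C, has_type C 1%N & finite_injdim C].

Definition canonical_ideal (J : set R) : Prop :=
  is_ideal J /\
  exists (C : lmodType R) (f : {linear C -> R^o}),
    [/\ canonical_module C, injective f & J = range f].

Definition has_canonical_reduction : Prop :=
  exists J : set R,
    canonical_ideal J /\ is_reduction J [set x | x \in @maxideal R].

End Canonical.

Arguments has_canonical_reduction : clear implicits.

(* Main.v *)
Require Import Defs.
From HB Require Import structures.
From mathcomp Require Import all_boot all_algebra ring.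
From mathcomp Require Import boolp classical_sets.

Set Implicit Arguments.
Unset Strict Implicit.
Unset Printing Implicit Defensive.

Import GRing.Theory.
Local Open Scope classical_set_scope.
Local Open Scope ring_scope.

(** For an ideal [J] containing a regular element of a one-dimensional
    Cohen-Macaulay local ring [R], being canonical is an elementary condition:
    for each regular nonunit [a], [J/aJ] is injective over [R/a] and has a
    one-dimensional socle.  Necessity is Bass's dimension shifting in a finite
    injective resolution; sufficiency comes from the explicit resolution
    [0 -> J -> Q -> Q/J -> 0], where [Q = R[1/a]].

    Let [M] be [R] or [m], regarded as an ideal.  If [J] is canonical in [R],
    then so is [(J : M) x J = Hom_R(R |x M, J)] in [R |x M], provided that the
    colon taken in [Q] lies in [R].  Conversely, if [J'] is canonical in
    [R |x M], then [L = {l | (0, l) \in J'}] is canonical in [R], and the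
    projection [P] of [J'] to [R] is [L : M].

    Reductions lift since [(m x M) ^ (k + 1) = m ^ (k + 1) x m ^ k M].  They
    descend since [P] is a reduction of [m]; this settles [M = R], where
    [P = L].  For [M = m], suppose [R] is not a discrete valuation ring.
    Then [m : m] is larger than [R = L : L], so [bl \notin L] for some
    [b \in m : m] and [l \in L].  As [P/L] has length one, [P = L + R bl],
    and [bl m ^ k = l (b m ^ k)] lies in [L m ^ k], so [L] is a reduction too.
    If [R] is a discrete valuation ring, then [P = m] and [L = xP] with
    [m = xR], so [m] itself is canonical.  This case also covers [J = m] in the
    ascent, where [(J : m) x J] is the unit ideal and is replaced by its
    multiple by [(x, 0)]. *)

(** * Submodules, quotient modules and linear maps *)

Section Submodules.
Variable R : comUnitRingType.

Definition is_submod (V : lmodType R) (U : set V) : Prop :=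
  U 0 /\ forall a x y, U x -> U y -> U (a *: x + y).

Section Closure.
Variables (V : lmodType R) (U : set V) (HU : is_submod U).

Lemma submod0 : U 0. Proof. by case: HU. Qed.

Lemma submodD x y : U x -> U y -> U (x + y).
Proof. by move=> Ux Uy; rewrite -[x]scale1r; apply: HU.2. Qed.

Lemma submodZ a x : U x -> U (a *: x).
Proof. by move=> Ux; rewrite -[_ *: _]addr0; apply: HU.2 => //; case: HU. Qed.

Lemma submodN x : U x -> U (- x).
Proof. by move=> Ux; rewrite -scaleN1r; apply: submodZ. Qed.

Lemma submodB x y : U x -> U y -> U (x - y).
Proof. by move=> Ux Uy; apply: submodD => //; apply: submodN. Qed.

Lemma submod_sum I (r : seq I) (P : pred I) (F : I -> V) :
  (forall i, P i -> U (F i)) -> U (\sum_(i <- r | P i) F i).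
Proof.
by move=> UF; elim/big_ind: _ => //; [apply: submod0 | apply: submodD].
Qed.

End Closure.

Record submodule (V : lmodType R) :=
  Submodule { submod_set :> V -> Prop; submodP : @is_submod V submod_set }.

Definition submod_pred (V : lmodType R) (U : submodule V) : pred V :=
  fun x => `[< U x >].

Lemma submod_predP (V : lmodType R) (U : submodule V) :
  submod_closed (submod_pred U).
Proof.
case: (submodP U) => U0 UD; split; first exact/asboolP.
by move=> a x y /asboolP Ux /asboolP Uy; apply/asboolP/UD.
Qed.

HB.instance Definition _ (V : lmodType R) (U : submodule V) :=
  GRing.isSubmodClosed.Build R V (submod_pred U) (submod_predP U).

Record subm (V : lmodType R) (U : submodule V) : predArgType :=
  Subm { subm_val : V; _ : subm_val \in submod_pred U }.

HB.instance Definition _ (V : lmodType R) (U : submodule V) :=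
  [isSub for @subm_val V U].
HB.instance Definition _ (V : lmodType R) (U : submodule V) :=
  [Choice of subm U by <:].
HB.instance Definition _ (V : lmodType R) (U : submodule V) :=
  [SubChoice_isSubLmodule of subm U by <:].

Lemma subm_valP (V : lmodType R) (U : submodule V) (x : subm U) : U (val x).
Proof. by apply/asboolP; exact: (valP x). Qed.

Lemma subm_valL (V : lmodType R) (U : submodule V) :
  linear (val : subm U -> V).
Proof. exact: linearP. Qed.

Lemma subm_valZ (V : lmodType R) (U : submodule V) k (x : subm U) :
  val (k *: x) = k *: val x.
Proof. by []. Qed.

Lemma subm_ex (V : lmodType R) (U : submodule V) x :
  U x -> exists y : subm U, val y = x.
Proof. by move=> /asboolP Ux; exists (Subm Ux). Qed.

Definition quotm (V : lmodType R) (U : submodule V) : Type :=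
  @Quotient.quot V (GRing.ZmodClosed.clone V (submod_pred U) _).

HB.instance Definition _ (V : lmodType R) (U : submodule V) :=
  GRing.Zmodule.on (quotm U).

Section QuotientModule.
Variables (V : lmodType R) (U : submodule V).

Definition quotpi (x : V) : quotm U :=
  (\pi_(@Quotient.quot V (GRing.ZmodClosed.clone V (submod_pred U) _)) x)%qT.

Lemma quotpiD : {morph quotpi : x y / x + y}.
Proof. exact: raddfD. Qed.

Lemma quotpi_eq x y : quotpi x = quotpi y <-> U (x - y).
Proof.
split=> [/eqP|Uxy].
  by rewrite /quotpi -Quotient.idealrBE => /asboolP.
by apply/eqP; rewrite /quotpi -Quotient.idealrBE; apply/asboolP.
Qed.

Lemma quotpi_repr (q : quotm U) : exists x, quotpi x = q.
Proof. by exists (repr q); apply: reprK. Qed.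

Definition quotrep (q : quotm U) : V := projT1 (cid (quotpi_repr q)).

Lemma quotrepK q : quotpi (quotrep q) = q.
Proof. exact: (projT2 (cid (quotpi_repr q))). Qed.

Definition quot_scale a q := quotpi (a *: quotrep q).

Lemma quot_scaleE a x : quot_scale a (quotpi x) = quotpi (a *: x).
Proof.
apply/quotpi_eq; rewrite -scalerBr.
by apply: (submodZ (submodP U)); apply/quotpi_eq; rewrite quotrepK.
Qed.

Lemma quot_scaleA a b q : quot_scale a (quot_scale b q) = quot_scale (a * b) q.
Proof. by rewrite -(quotrepK q) !quot_scaleE scalerA. Qed.

Lemma quot_scale1 : left_id 1 quot_scale.
Proof. by move=> q; rewrite /quot_scale scale1r quotrepK. Qed.

Lemma quot_scaleDr : right_distributive quot_scale +%R.
Proof.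
move=> a q q'; rewrite -(quotrepK q) -(quotrepK q') -quotpiD !quot_scaleE.
by rewrite scalerDr quotpiD.
Qed.

Lemma quot_scaleDl q : {morph quot_scale^~ q : a b / a + b}.
Proof.
by move=> a b; rewrite -(quotrepK q) !quot_scaleE scalerDl quotpiD.
Qed.

HB.instance Definition _ := GRing.Zmodule_isLmodule.Build R (quotm U)
  quot_scaleA quot_scale1 quot_scaleDr quot_scaleDl.

Lemma quotpiZ a x : quotpi (a *: x) = a *: quotpi x.
Proof. by rewrite -quot_scaleE. Qed.

Lemma quotpi_linear : linear quotpi.
Proof. by move=> a x y; rewrite quotpiD quotpiZ. Qed.

HB.instance Definition _ := GRing.isLinear.Build R V (quotm U) _ quotpi
  quotpi_linear.

Lemma quotpi_eq0 x : quotpi x = 0 <-> U x.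
Proof. by rewrite -(linear0 quotpi) quotpi_eq subr0. Qed.

End QuotientModule.

Lemma linZ (V W : lmodType R) (f : {linear V -> W}) a x :
  f (a *: x) = a *: f x.
Proof. exact: linearZ. Qed.

Lemma linD (V W : lmodType R) (f : {linear V -> W}) x y :
  f (x + y) = f x + f y.
Proof. exact: linearD. Qed.

Lemma linB (V W : lmodType R) (f : {linear V -> W}) x y :
  f (x - y) = f x - f y.
Proof. exact: linearB. Qed.

Lemma lin0 (V W : lmodType R) (f : {linear V -> W}) : f 0 = 0.
Proof. exact: linear0. Qed.

Lemma linP (V W : lmodType R) (f : {linear V -> W}) a x y :
  f (a *: x + y) = a *: f x + f y.
Proof. exact: linearP. Qed.

Lemma linear_comb (V W : lmodType R) (f : {linear V -> W}) n (c : 'I_n -> R)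
  (g : 'I_n -> V) : f (\sum_i c i *: g i) = \sum_i c i *: f (g i).
Proof.
elim: n c g => [|n IH] c g; first by rewrite !big_ord0 linear0.
by rewrite !big_ord_recl linearD linearZ /= IH.
Qed.

Definition mklin (V W : lmodType R) (f : V -> W) (lf : linear f) :
  {linear V -> W} := HB.pack f (GRing.isLinear.Build R V W _ f lf).

Lemma mklinE (V W : lmodType R) (f : V -> W) (lf : linear f) x :
  mklin lf x = f x.
Proof. by []. Qed.

End Submodules.

(** * Noetherian modules *)

Section Noetherian.
Variable R : comUnitRingType.

Definition noeth_mod (V : lmodType R) : Prop :=
  forall U : set V, is_submod U -> exists n (g : 'I_n -> V),
    forall x, U x <-> exists c : 'I_n -> R, x = \sum_i c i *: g i.

Lemma noeth_ring : noetherian R -> noeth_mod R^o.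
Proof.
move=> HR U HU; have [n [g Ug]] := HR U HU; exists n, g => x.
by rewrite Ug.
Qed.

(** Lifts to [U] of generators of [p U], together with generators of the part of [U] coming from
    [K], generate [U]. *)
Lemma noeth_mod_ext (V W K : lmodType R) (p : {linear V -> W})
    (i : {linear K -> V}) :
  (forall x, p x = 0 -> exists k, i k = x) ->
  noeth_mod W -> noeth_mod K -> noeth_mod V.
Proof.
move=> pi HW HK U HU.
have HpU : is_submod [set y | exists2 x, U x & p x = y].
  split; first by exists 0; [case: HU | rewrite linear0].
  move=> a _ _ [x Ux <-] [y Uy <-]; exists (a *: x + y); last exact: linearP.
  exact: HU.2.
have HiU : is_submod [set k | U (i k)].
  split; first by rewrite /= linear0; case: HU.
  by move=> a x y /= Ux Uy; rewrite linearP; apply: HU.2.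
have [n [g Hg]] := HW _ HpU; have [m [h Hh]] := HK _ HiU.
have gU j : exists x, U x /\ p x = g j.
  have [|x Ux <-] := (Hg (g j)).2; last by exists x.
  exists (fun l => (l == j)%:R); rewrite (bigD1 j) //= eqxx scale1r big1 ?addr0//.
  by move=> l /negbTE ->; rewrite scale0r.
have hU j : U (i (h j)).
  apply: (Hh (h j)).2.
  exists (fun l => (l == j)%:R); rewrite (bigD1 j) //= eqxx scale1r big1 ?addr0//.
  by move=> l /negbTE ->; rewrite scale0r.
have [G HG] := choice gU.
exists (n + m)%N, (fun j => match split j with inl j => G j | inr j => i (h j) end).
move=> x; split.
  move=> Ux; have [|c pxE] := (Hg (p x)).1; first by exists x.
  have [|k ik] := pi (x - \sum_j c j *: G j).
    by rewrite linearB linear_comb pxE -sumrB big1 // => j _; rewrite (HG j).2 subrr.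
  have [|c' kE] := (Hh k).1.
    rewrite /= ik; apply: submodB => //; apply: submod_sum => // j _.
    by apply: submodZ => //; apply: (HG j).1.
  exists (fun j => match split j with inl j => c j | inr j => c' j end).
  rewrite big_split_ord /= -[LHS](subrK (\sum_j c j *: G j)) -ik [LHS]addrC.
  congr (_ + _).
    by apply: eq_bigr => j _; rewrite (unsplitK (inl _ j)).
  rewrite kE linear_comb; apply: eq_bigr => j _.
  by rewrite (unsplitK (inr _ j)).
move=> [c ->]; apply: submod_sum => // j _; apply: submodZ => //.
by case: (split j) => // j'; case: (HG j').
Qed.

(** Splitting off the first coordinate. Rows serve to record the values of a map on the generators
    of an ideal. *)
Lemma noeth_row : noetherian R -> forall r, noeth_mod 'rV[R]_r.
Proof.
move=> HR; elim=> [|r IH].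
  move=> U [U0 _]; exists 0, (fun=> 0) => x; split=> [_|_].
    by exists (fun=> 0); rewrite big_ord0; apply/rowP; case.
  by rewrite (_ : x = 0) //; apply/rowP; case.
pose p (x : 'rV[R]_(1 + r)) : R^o := x 0 (lshift r 0).
have lp : linear p by move=> a x y; rewrite /p !mxE.
pose i (x : 'rV[R]_r) : 'rV[R]_(1 + r) := row_mx 0 x.
have li : linear i.
  by move=> a x y; rewrite /i scale_row_mx add_row_mx scaler0 addr0.
apply: (@noeth_mod_ext _ _ _ (mklin lp) (mklin li) _ (noeth_ring HR) IH) => x.
rewrite mklinE /p => x0; exists (rsubmx x); rewrite mklinE /i.
rewrite -[RHS]hsubmxK; congr row_mx; apply/rowP => j.
by rewrite ord1 !mxE.
Qed.

(* Krull's intersection theorem for a submodule [U]: the submodules [U + R w_n]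
   form an ascending chain. *)
Lemma krull_chain (V : lmodType R) (U : set V) (w : nat -> V) (a : R) :
  noeth_mod V -> is_submod U -> (forall c, 1 - c * a \is a GRing.unit) ->
  (forall n, U (w n - a *: w n.+1)) -> U (w 0%N).
Proof.
move=> HV HU aJ Hw.
have step k n : exists r, U (w n - r *: w (n + k)%N).
  elim: k => [|k [r IH]].
    by exists 1; rewrite addn0 scale1r subrr; case: HU.
  exists (r * a); rewrite addnS -[X in U X](subrKA (r *: w (n + k)%N)).
  apply: submodD => //; rewrite -scalerA -scalerBr; exact: submodZ.
have mono n m r : (n <= m)%N -> exists s, U (r *: w n - s *: w m).
  move=> /subnKC <-; have [s Us] := step (m - n)%N n.
  by exists (r * s); rewrite -scalerA -scalerBr; exact: submodZ.
pose W := [set x | exists n r, U (x - r *: w n)].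
have HW : is_submod W.
  split; first by exists 0%N, 0; rewrite scale0r subr0; case: HU.
  move=> b x y [n [r Ux]] [m [s Uy]].
  have [r' Ur] := mono n (maxn n m) r (leq_maxl _ _).
  have [s' Us] := mono m (maxn n m) s (leq_maxr _ _).
  exists (maxn n m), (b * r' + s').
  rewrite scalerDl -scalerA opprD addrACA -scalerBr.
  apply: HU.2; first by rewrite -[x](subrK (r *: w n)) -addrA; apply: submodD.
  by rewrite -[y](subrK (s *: w m)) -addrA; apply: submodD.
have [q [g Hg]] := HV _ HW.
have gW j : W (g j).
  apply: (Hg (g j)).2.
  exists (fun l => (l == j)%:R); rewrite (bigD1 j) //= eqxx scale1r big1 ?addr0//.
  by move=> l /negbTE ->; rewrite scale0r.
have [N /choice [f Hf]] : exists N, forall j, exists r, U (g j - r *: w N).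
  have [nn Hn] := choice gW; exists (\max_j nn j) => j.
  have [r Ur] := Hn j; have [s Us] := mono _ (\max_j nn j) r (leq_bigmax j).
  by exists s; rewrite -[g j](subrK (r *: w (nn j))) -addrA; apply: submodD.
have [|c wE] := (Hg (w N.+1)).1.
  by exists N.+1, 1; rewrite scale1r subrr; case: HU.
(* The chain stops at [N], so modulo [U] one has [w (N + 1) = e w N = e a w (N + 1)]; since
   [1 - e a] is a unit, [w (N + 1)] lies in [U]. *)
pose e := \sum_j c j * f j.
have UN : U (w N.+1 - e *: w N).
  rewrite wE /e scaler_suml -sumrB; apply: submod_sum => // j _.
  by rewrite -scalerA -scalerBr; apply: submodZ.
have UN1 : U (w N.+1).
  have : U ((1 - e * a) *: w N.+1).
    rewrite scalerBl scale1r -[X in U X](subrKA (e *: w N)) -scalerA -scalerBr.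
    by apply: submodD => //; apply: submodZ.
  by move/(submodZ HU (1 - e * a)^-1); rewrite scalerA mulVr // scale1r.
have [s] := step N.+1 0%N; rewrite add0n => Us.
by rewrite -[w 0%N](subrK (s *: w N.+1)); apply: submodD => //; apply: submodZ.
Qed.

(** Otherwise choice yields a strictly increasing sequence in [F]; finitely many generators of its
    union already lie in one term. *)
Lemma noetherian_max (F : set (set R)) (I0 : set R) :
  noetherian R -> (forall I, F I -> is_ideal I) -> F I0 ->
  exists2 I, F I & forall K, F K -> I `<=` K -> K `<=` I.
Proof.
move=> HR FI F0; apply: contrapT => nmax.
have nxt (I : {I | F I}) : exists K : {I | F I},
    projT1 I `<=` projT1 K /\ ~ (projT1 K `<=` projT1 I).
  case: I => I FI'; apply: contrapT => nK; apply: nmax; exists I => // K FK IK.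
  by apply: contrapT => nKI; apply: nK; exists (exist _ K FK).
have [f Hf] := choice nxt.
pose s n := projT1 (iter n f (exist _ I0 F0)).
have sF n : F (s n) by rewrite /s; case: (iter _ _ _).
have sS n : s n `<=` s n.+1 by case: (Hf (iter n f (exist _ I0 F0))).
have sm n m : (n <= m)%N -> s n `<=` s m.
  move=> /subnKC <-; elim: (m - n)%N => [|k IH]; first by rewrite addn0.
  by rewrite addnS; apply: subset_trans IH (sS _).
have HU : is_ideal [set x | exists n, s n x].
  split; first by exists 0%N; case: (FI _ (sF 0%N)).
  move=> a x y [n sx] [m sy]; exists (maxn n m).
  apply: (FI _ (sF _)).2; first by apply: sm sx; apply: leq_maxl.
  by apply: sm sy; apply: leq_maxr.
have [n [g Ug]] := HR _ HU.
have gU j : exists n, s n (g j).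
  suff : [set x | exists n, s n x] (g j) by [].
  rewrite Ug; exists (fun l => (l == j)%:R).
  rewrite (bigD1 j) //= eqxx mul1r big1 ?addr0//.
  by move=> l /negbTE ->; rewrite mul0r.
have [nn Hn] := choice gU; pose N := \max_j nn j.
apply: ((Hf (iter N f (exist _ I0 F0))).2) => x sx.
have : [set x | exists n, s n x] x by exists N.+1.
rewrite Ug => -[c ->]; apply: (@submod_sum R R^o (s N) (FI _ (sF N))) => j _.
apply: (@submodZ R R^o (s N) (FI _ (sF N))); apply: sm (Hn j).
exact: leq_bigmax.
Qed.

Lemma noetherian_stab (F : nat -> set R) :
  noetherian R -> (forall n, is_ideal (F n)) -> (forall n, F n `<=` F n.+1) ->
  exists N, forall n, F n `<=` F N.
Proof.
move=> HR FI FS.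
have sm n m : (n <= m)%N -> F n `<=` F m.
  move=> /subnKC <-; elim: (m - n)%N => [|k IH]; first by rewrite addn0.
  by rewrite addnS; apply: subset_trans IH (FS _).
have [||_ [N _ <-] HN] := @noetherian_max (range F) (F 0%N) HR.
- by move=> _ [n _ <-].
- by exists 0%N.
exists N => n; have [nN|Nn] := leqP n N; first exact: sm.
by apply: HN; [exists n|apply: sm; apply: ltnW].
Qed.

End Noetherian.

(** * Elementary operations on ideals *)

Section IdealBasics.
Variable R : comUnitRingType.
Implicit Types I : set R.

Lemma ideal_submod I : is_ideal I -> @is_submod R R^o I. Proof. by []. Qed.

Lemma ideal0 I : is_ideal I -> I 0. Proof. by case. Qed.

Lemma idealD I x y : is_ideal I -> I x -> I y -> I (x + y).
Proof. by move=> HI; apply: (@submodD R R^o I HI). Qed.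

Lemma idealB I x y : is_ideal I -> I x -> I y -> I (x - y).
Proof. by move=> HI; apply: (@submodB R R^o I HI). Qed.

Lemma idealN I x : is_ideal I -> I x -> I (- x).
Proof. by move=> HI; apply: (@submodN R R^o I HI). Qed.

Lemma ideal_mull I a x : is_ideal I -> I x -> I (a * x).
Proof. by move=> HI; apply: (@submodZ R R^o I HI). Qed.

Lemma ideal_mulr I a x : is_ideal I -> I x -> I (x * a).
Proof. by rewrite mulrC; apply: ideal_mull. Qed.

Definition ideal_adjoin I y : set R := [set x | exists r i, I i /\ x = r * y + i].

Lemma ideal_adjoinP I y : is_ideal I -> is_ideal (ideal_adjoin I y).
Proof.
move=> HI; split; first by exists 0, 0; split; [case: HI | ring].
move=> a _ _ [r [i [Ii ->]]] [s [j [Ij ->]]].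
exists (a * r + s), (a * i + j); split; last by ring.
by apply: HI.2.
Qed.

Lemma sub_ideal_adjoin I y : I `<=` ideal_adjoin I y.
Proof. by move=> x Ix; exists 0, x; split=> //; ring. Qed.

Lemma mem_ideal_adjoin I y : is_ideal I -> ideal_adjoin I y y.
Proof. by move=> HI; exists 1, 0; split; [case: HI | ring]. Qed.

Definition dilate a I : set R := [set x | exists2 i, I i & x = a * i].

Lemma dilateP a I : is_ideal I -> is_ideal (dilate a I).
Proof.
move=> HI; split; first by exists 0; [case: HI | ring].
move=> b _ _ [i Ii ->] [j Ij ->]; exists (b * i + j); last by ring.
exact: HI.2.
Qed.

Lemma lreg_eq0 (a x : R) : GRing.lreg a -> a * x = 0 -> x = 0.
Proof. by move=> ra /eqP; rewrite mulrI_eq0 // => /eqP. Qed.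

End IdealBasics.

(** * Local rings of dimension one *)

Section LocalAlgebra.
Variable R : localRingType.
Hypotheses (HR : noetherian R) (Hdim : ~ prime_chain R 2).

Lemma max_closed : is_ideal [set x : R | x \isn't a GRing.unit].
Proof.
split=> [|a x y /= ux uy]; first by rewrite /= unitr0.
by apply: nonunitD => //; rewrite unitrM negb_and ux orbT.
Qed.

Lemma nonunitMl (a x : R) : x \isn't a GRing.unit -> a * x \isn't a GRing.unit.
Proof. by move=> ux; rewrite unitrM negb_and ux orbT. Qed.

Lemma unit_1B (a c : R) : a \isn't a GRing.unit -> 1 - c * a \is a GRing.unit.
Proof.
move=> ua; apply: contraT => u1.
by have := nonunitD _ _ u1 (nonunitMl c ua); rewrite subrK unitr1.
Qed.

(** Otherwise [P0 < p < m] would be a chain of primes, where [P0] is maximal among the ideals free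
    of products [b ^ k * s] with [s] outside [p]. The zero ideal is free of them because [b] is
    regular. *)
Lemma prime_regular_max (p : set R) b : is_prime_ideal p -> p b ->
  GRing.lreg b -> forall x, x \isn't a GRing.unit -> p x.
Proof.
move=> [Ip p1 pP] pb rb y uy; apply: contrapT => npy; apply: Hdim.
pose F (I : set R) := is_ideal I /\ forall k s, ~ p s -> ~ I (b ^+ k * s).
have F0 : F [set 0].
  split; first by split=> // a x z -> ->; rewrite /=; ring.
  move=> k s ps /= /(lreg_eq0 (lregX rb)) s0; apply: ps; rewrite s0.
  exact: ideal0.
have [|P0 [IP0 nP0] maxP0] := noetherian_max HR _ F0; first by move=> I [].
have P0p : P0 `<=` p.
  by move=> x P0x; apply: contrapT => /(nP0 0%N); rewrite expr0 mul1r.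
have nP0b : ~ P0 b by have := nP0 1%N 1 p1; rewrite mulr1.
have ext x : ~ P0 x -> exists k s r i, [/\ ~ p s, P0 i & b ^+ k * s = r * x + i].
  move=> nP0x; apply: contrapT => nex; apply: nP0x.
  apply: (maxP0 (ideal_adjoin P0 x)); last exact: mem_ideal_adjoin.
    split; first exact: ideal_adjoinP.
    by move=> k s ps [r [i [P0i e]]]; apply: nex; exists k, s, r, i.
  exact: sub_ideal_adjoin.
have primeP0 : is_prime_ideal P0.
  split=> //; first by move=> /P0p.
  move=> x z P0xz; apply: contrapT => /not_orP[/ext[k [s [r [i [ps P0i e]]]]]].
  move=> /ext[k' [s' [r' [i' [ps' P0i' e']]]]].
  apply: (nP0 (k + k')%N (s * s')); first by move=> /pP[].
  have -> : b ^+ (k + k') * (s * s') = (b ^+ k * s) * (b ^+ k' * s').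
    by rewrite exprD; ring.
  rewrite e e' (_ : (r * x + i) * (r' * z + i') =
      (r * r') * (x * z) + ((r' * z + i') * i + (r * x) * i')).
    by apply: (idealD IP0 (ideal_mull _ IP0 _)
      (idealD IP0 (ideal_mull _ IP0 _) (ideal_mull _ IP0 _))).
  by ring.
pose m := [set x : R | x \isn't a GRing.unit].
exists (fun n => if n is n'.+1 then if n' is n''.+1 then m else p else P0); split.
  case=> [|[|n]] _ //; split; first exact: max_closed.
    by rewrite /m /= unitr1.
  by move=> x z; rewrite /m /= unitrM negb_and => /orP.
case=> [|[|n]] // _; split=> //; first by move=> /(_ b pb).
  by move=> x px; apply/negP => ux; apply: p1; rewrite -(mulVr ux); apply: ideal_mull.
by move=> /(_ y uy).
Qed.

(** A maximal element among the annihilators of the nonzero multiples of [v] in [V/U] is prime. It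
    contains the regular element [b], hence all nonunits. *)
Lemma exists_socle (V : lmodType R) (U : set V) v b :
  is_submod U -> ~ U v -> GRing.lreg b -> U (b *: v) ->
  exists r, ~ U (r *: v) /\
    forall x, x \isn't a GRing.unit -> U (x *: (r *: v)).
Proof.
move=> HU nUv rb Ubv.
pose ann r := [set x : R | U (x *: (r *: v))].
have annP r : is_ideal (ann r).
  split; first by rewrite /ann /= scale0r; case: HU.
  by move=> a x y Ux Uy; rewrite /ann /= scalerDl -scalerA; apply: HU.2.
have [| |_ [r nUr <-] maxI] :=
  @noetherian_max _ (ann @` [set r | ~ U (r *: v)]) (ann 1) HR.
- by move=> _ [r _ <-].
- by exists 1 => //=; rewrite scale1r.
exists r; split=> // x ux.
have annb : ann r b.
  by rewrite /ann /= scalerA mulrC -scalerA; apply: submodZ.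
apply: (@prime_regular_max (ann r) b) => //; split=> //.
  by rewrite /ann /= scale1r.
move=> y z Uyz; apply: contrapT => /not_orP[ny nz]; apply: nz.
apply: (maxI (ann (y * r))).
- by exists (y * r) => //=; rewrite -scalerA.
- move=> w Uw; rewrite /ann /=.
  have -> : w *: ((y * r) *: v) = y *: (w *: (r *: v)).
    by rewrite !scalerA; congr (_ *: _); ring.
  exact: submodZ.
- rewrite /ann /=; have -> // : z *: ((y * r) *: v) = (y * z) *: (r *: v).
  by rewrite !scalerA; congr (_ *: _); ring.
Qed.

Lemma exists_socle_ideal (I : set R) v b :
  is_ideal I -> ~ I v -> GRing.lreg b -> I (b * v) ->
  exists r, ~ I (r * v) /\ forall x, x \isn't a GRing.unit -> I (x * (r * v)).
Proof. by move=> HI; apply: (@exists_socle R^o). Qed.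

End LocalAlgebra.

(** * Injective modules and finite injective resolutions *)

Section Relations.
Variable R : comUnitRingType.

(** A submodule of [V x W], seen as a linear map that is defined on a submodule only and may be
    multivalued; it is single-valued once [G 0 e] forces [e = 0]. Maps out of ideals take this form,
    which avoids making each ideal a module. *)
Definition linear_rel (V W : lmodType R) (G : V -> W -> Prop) : Prop :=
  G 0 0 /\ forall a x y v w, G x v -> G y w -> G (a *: x + y) (a *: v + w).

Lemma linear_rel_fun (V W : lmodType R) (G : V -> W -> Prop) x v w :
  linear_rel G -> (forall e, G 0 e -> e = 0) -> G x v -> G x w -> v = w.
Proof.
move=> [_ GD] Gf Gv Gw; apply/eqP; rewrite -subr_eq0; apply/eqP/Gf.
have -> : 0 = -1 *: x + x :> V by rewrite scaleN1r addNr.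
by rewrite [v - w]addrC -[- w]scaleN1r; apply: GD.
Qed.

Lemma inj_ext_rel (E V : lmodType R) (G : V -> E -> Prop) :
  injective_module E -> linear_rel G -> (forall e, G 0 e -> e = 0) ->
  exists h : {linear V -> E}, forall x e, G x e -> h x = e.
Proof.
move=> HE HG Gf; have [G0 GD] := HG.
have Guniq x e e' : G x e -> G x e' -> e = e' by exact: linear_rel_fun.
pose U : set V := [set x | exists e, G x e].
have HU : is_submod U.
  split; first by exists 0.
  by move=> a x y [e Ge] [e' Ge']; exists (a *: e + e'); apply: GD.
pose S := Submodule HU.
have lf : linear (val : subm S -> V) by move=> a x y; rewrite linP.
have Hg (x : subm S) : exists e, G (val x) e by exact: subm_valP x.
have [g gP] := choice Hg.
have lg : linear g.
  by move=> a x y; apply: Guniq (gP _) _; rewrite lf; apply: GD.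
have [|h hP] := HE (subm S) V (mklin lf) (mklin lg); first exact: val_inj.
exists h => x e Gxe.
have [|y yx] := @subm_ex _ _ S x; first by exists e.
rewrite -yx; move: (hP y); rewrite !mklinE => ->; apply: Guniq (gP y) _.
by rewrite yx.
Qed.

Lemma inj_ext_ideal (E : lmodType R) (G : R -> E -> Prop) :
  injective_module E -> @linear_rel R^o E G -> (forall e, G 0 e -> e = 0) ->
  exists e, forall x v, G x v -> v = x *: e.
Proof.
move=> HE HG Gf; have [h hP] := @inj_ext_rel E R^o G HE HG Gf.
exists (h 1) => x v /hP <-.
by rewrite -linZ; congr (h _); rewrite /GRing.scale /= mulr1.
Qed.

(** As [a] is regular, [a r] may be sent to [r e]; the extension of this map is multiplication by
    [w]. *)
Lemma inj_divisible (E : lmodType R) (a : R) (e : E) :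
  injective_module E -> GRing.lreg a -> exists w, e = a *: w.
Proof.
move=> HE ra; pose G x v := exists2 r : R, x = a * r & v = r *: e.
have [||w wP] := @inj_ext_ideal E G HE.
- split; first by exists 0; rewrite ?mulr0 ?scale0r.
  move=> b _ _ _ _ [r -> ->] [s -> ->]; exists (b * r + s).
    by rewrite /GRing.scale /=; ring.
  by rewrite scalerDl scalerA.
- by move=> _ [r /esym /(lreg_eq0 ra) -> ->]; rewrite scale0r.
by exists w; apply: wP; exists 1; rewrite ?mulr1 ?scale1r.
Qed.

(* [C/aC] is injective over [R/a] and has a one-dimensional socle.  A relation
   [G] stands for a linear map from an ideal containing [a], which it sends to
   [0], to [C/aC]; the hypothesis on [G (a * r) c] also gives single-valuedness. *)
Definition ext_prop (C : lmodType R) (a : R) : Prop :=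
  forall G : R -> C -> Prop, @linear_rel R^o C G ->
    (forall r c, G (a * r) c -> exists c', c = a *: c') ->
    exists y, forall x c, G x c -> exists c', c - x *: y = a *: c'.

Definition soc_prop (C : lmodType R) (a : R) : Prop :=
  exists t : C, [/\ ~ (exists c, t = a *: c),
    forall x, x \isn't a GRing.unit -> exists c, x *: t = a *: c &
    forall y, (forall x, x \isn't a GRing.unit -> exists c, x *: y = a *: c) ->
      exists s c, y = s *: t + a *: c].

End Relations.

(** * Linear maps out of the residue field *)

Section ResidueMaps.
Variable R : localRingType.

Lemma residue_surj (x : residue_field R) : exists r, residue r = x.
Proof. by exists (repr x); apply: reprK. Qed.

Lemma residue_eq (r r' : R) :
  residue r = residue r' -> r - r' \isn't a GRing.unit.
Proof. by move/eqP; rewrite /residue -Quotient.idealrBE. Qed.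

Lemma residue_eq0 (r : R) : r \isn't a GRing.unit -> residue r = 0.
Proof.
move=> ur; have -> : 0 = residue (0 : R) by rewrite /residue rmorph0.
by apply/eqP; rewrite /residue -Quotient.idealrBE subr0.
Qed.

Lemma residue_scale_one (r : R) : r *: (residue 1 : residue_field R) = residue r.
Proof. by rewrite {1}/GRing.scale /= /residue_scale -residueM mulr1. Qed.

(** Together with [residue_scale_one], this identifies [Hom (k, W)] with the socle of [W] through
    the value at [1]. *)
Lemma residue_map (W : lmodType R) (z : W) :
  (forall x, x \isn't a GRing.unit -> x *: z = 0) ->
  exists f : {linear residue_field R -> W}, f (residue 1) = z.
Proof.
move=> mz; have /choice[p pP] := residue_surj.
have fE x r : residue r = x -> p x *: z = r *: z.
  move=> rx; apply/eqP; rewrite -subr_eq0 -scalerBl mz //; apply: residue_eq.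
  by rewrite pP.
have lf : linear (fun x => p x *: z).
  move=> a x y; rewrite (fE _ (a * p x + p y)) ?scalerDl ?scalerA //.
  by rewrite residueD residueM !pP.
by exists (mklin lf); rewrite mklinE (fE _ 1) ?scale1r.
Qed.

End ResidueMaps.

(** * Dimension shifting in an injective resolution *)

Section Resolution.
Variable R : localRingType.
Hypotheses (HR : noetherian R) (Hdim : ~ prime_chain R 2).
Variables (C : lmodType R) (I : nat -> lmodType R) (eta : {linear C -> I 0%N}).
Variable (d : forall n, {linear I n -> I n.+1}).
Hypothesis (res : injective_resolution eta d).

Let injI n : injective_module (I n). Proof. by case: res. Qed.
Let exd n (y : I n.+1) : d n.+1 y = 0 -> exists x, d n x = y.
Proof. by case: res => _ _ _ H /H. Qed.
Let dd n (x : I n) : d n.+1 (d n x) = 0.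
Proof. by case: res => _ _ _ H; apply/H; exists x. Qed.
Let ex0 (y : I 0%N) : d 0%N y = 0 -> exists x, eta x = y.
Proof. by case: res => _ _ H _ /H. Qed.
Let deta x : d 0%N (eta x) = 0.
Proof. by case: res => _ _ H _; apply/H; exists x. Qed.
Let eta_inj : injective eta. Proof. by case: res. Qed.

(* [Ext^(i + 2) (R/c, C) = 0]. *)
Definition ext_van i : Prop :=
  forall (c : set R) b (z : I i.+2), is_ideal c -> c b -> GRing.lreg b ->
    d i.+2 z = 0 -> (forall x, c x -> x *: z = 0) ->
    exists2 e : I i.+1, d i.+1 e = z & forall x, c x -> x *: e = 0.

(* Ext^(i + 2) (k, C) embeds in Ext^(i + 3) (R/(a, s), C), where [k] is the
   submodule of [R/a] generated by the socle element [s]. *)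
Lemma ext_van_socle i (a : R) (z : I i.+2) : ext_van i.+1 -> GRing.lreg a ->
  a \isn't a GRing.unit ->
  d i.+2 z = 0 -> (forall x, x \isn't a GRing.unit -> x *: z = 0) ->
  exists2 e : I i.+1, d i.+1 e = z &
    forall x, x \isn't a GRing.unit -> x *: e = 0.
Proof.
move=> IH ra ua dz mz.
have HaR : is_ideal (dilate a setT) by apply: dilateP.
have [||s0 [nas ms]] := exists_socle_ideal HR Hdim (v := 1) HaR _ ra.
- by case=> r _ /esym e; move/negP: ua; apply; apply/unitrPr; exists r.
- by exists 1.
move: nas ms; rewrite mulr1; move: s0 => s nas ms.
(* Extending [s -> z], [a -> 0] gives [e] with [s e = z] and [a e = 0]; its coboundary is then
   killed by [(a, s)]. *)
pose G x (v : I i.+2) := exists r r', x = r * s + r' * a /\ v = r *: z.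
have [||e eP] := @inj_ext_ideal _ _ G (@injI i.+2).
- split; first by exists 0, 0; split; [ring | rewrite scale0r].
  move=> b _ _ _ _ [r [r' [-> ->]]] [q [q' [-> ->]]].
  exists (b * r + q), (b * r' + q'); split; first by rewrite /GRing.scale /=; ring.
  by rewrite scalerDl scalerA.
- move=> _ [r [r' [e0 ->]]]; have [ur|] := boolP (r \is a GRing.unit); last exact: mz.
  case: nas; exists (- (r^-1 * r')) => //.
  apply: (can_inj (mulKr ur)).
  have -> : r * (a * - (r^-1 * r')) = - (r * r^-1) * (r' * a) by ring.
  by rewrite divrr // mulN1r -[LHS](addrK (r' * a)) -e0 sub0r.
have ze : s *: e = z by apply/esym/eP; exists 1, 0; split; [ring | rewrite scale1r].
have ae : a *: e = 0 by apply/esym/eP; exists 0, 1; split; [ring | rewrite scale0r].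
have [||x [r [_ [[i' _ ->] ->]]]|e' de' ce'] :=
  IH (ideal_adjoin (dilate a setT) s) a (d i.+2 e) (ideal_adjoinP _ HaR) _ ra.
- by apply: sub_ideal_adjoin; exists 1; rewrite ?mulr1.
- exact: dd.
- rewrite -linZ scalerDl -scalerA ze [a * i']mulrC -scalerA ae scaler0 addr0.
  by rewrite linZ dz scaler0.
have se' : s *: e' = 0 by apply: ce'; apply: mem_ideal_adjoin.
have ae' : a *: e' = 0.
  by apply/ce'/sub_ideal_adjoin; exists 1; rewrite ?mulr1.
have [|w dw] := @exd i.+1 (e - e'); first by rewrite linB de' subrr.
have [|w' dw'] := @exd i (a *: w).
  by rewrite linZ /= dw scalerBr ae ae' subrr.
have [w'' w'E] := inj_divisible w' (@injI i) ra.
(* The correction by [d i w''] makes [a] kill the bracket. A nonunit multiplies [s] into [aR], so it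
   kills [s] times the bracket. *)
exists (s *: (w - d i w'')).
  by rewrite linZ linB /= dd subr0 dw scalerBr ze se' subr0.
move=> x /ms [r _ xs]; rewrite scalerA xs mulrC -scalerA scalerBr -linZ.
by rewrite -w'E dw' subrr scaler0.
Qed.

(** For a maximal counterexample [c0] and a socle element [y] of [R/c0], the sequence
    [0 -> k -> R/c0 -> R/(c0, y) -> 0] leaves two vanishings to prove. The one for [k] is
    [ext_van_socle], the one for [R/(c0, y)] is maximality. *)
Lemma ext_van_step i : ext_van i.+1 -> ext_van i.
Proof.
move=> IH c b z Hc cb rb dz cz.
have [ub|ub] := boolP (b \is a GRing.unit).
  exists 0; last by move=> x _; rewrite scaler0.
  by rewrite lin0 -[z]scale1r -(mulVr ub) -scalerA cz // scaler0.
apply: contrapT => nex.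
pose F (c : set R) := [/\ is_ideal c, c b & ~ forall z : I i.+2, d i.+2 z = 0 ->
  (forall x, c x -> x *: z = 0) -> exists2 e : I i.+1, d i.+1 e = z &
  forall x, c x -> x *: e = 0].
have Fc : F c by split=> // /(_ z dz cz).
have [|c0 [Ic0 c0b nc0] maxc] := noetherian_max HR _ Fc; first by move=> J [].
apply: nc0 => {dz cz nex}z dz cz.
have [c1|c1] := pselect (c0 1).
  have z0 : z = 0 by rewrite -[z]scale1r cz.
  by exists 0; [rewrite z0 lin0 | move=> x _; rewrite scaler0].
have [|y0 [ny my]] := exists_socle_ideal HR Hdim Ic0 c1 rb; first by rewrite mulr1.
move: ny my; rewrite mulr1; move: y0 => y ny my.
have [|x ux|u du mu] := @ext_van_socle i b (y *: z) IH rb ub.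
- by rewrite linZ /= dz scaler0.
- by rewrite scalerA cz //; apply: my.
pose G x (v : I i.+1) := exists r j, [/\ c0 j, x = r * y + j & v = r *: u].
have [||e eP] := @inj_ext_ideal _ _ G (@injI i.+1).
- split; first by exists 0, 0; split; [exact: ideal0 | ring | rewrite scale0r].
  move=> k _ _ _ _ [r [j [cj -> ->]]] [r' [j' [cj' -> ->]]].
  exists (k * r + r'), (k * j + j'); split; first exact: Ic0.2.
    by rewrite /GRing.scale /=; ring.
  by rewrite scalerDl scalerA.
- move=> _ [r [j [cj e0 ->]]]; have [ur|] := boolP (r \is a GRing.unit); last exact: mu.
  case: ny; rewrite -(mulKr ur y); apply: (ideal_mull _ Ic0).
  by rewrite -[_ * y](addrK j) -e0 sub0r; apply: idealN.
have ye : y *: e = u.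
  apply/esym/eP; exists 1, 0; split; [exact: ideal0 | ring | by rewrite scale1r].
have ce x : c0 x -> x *: e = 0.
  by move=> cx; apply/esym/eP; exists 0, x; split; [| ring | rewrite scale0r].
have [e' de' ce'] : exists2 e' : I i.+1, d i.+1 e' = z - d i.+1 e &
    forall x, ideal_adjoin c0 y x -> x *: e' = 0.
  apply: contrapT => nex; apply: ny.
  apply: (maxc (ideal_adjoin c0 y)); last exact: mem_ideal_adjoin.
  - split; [exact: ideal_adjoinP | exact: sub_ideal_adjoin|].
    move=> H; apply: nex; apply: H.
    + by rewrite linB dz dd subrr.
    + move=> _ [r [j [cj ->]]].
      have Y : y *: (z - d i.+1 e) = 0 by rewrite scalerBr -linZ ye du subrr.
      have J : j *: (z - d i.+1 e) = 0.
        by rewrite scalerBr -linZ ce // cz // lin0 subrr.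
      by rewrite scalerDl -scalerA Y J scaler0 addr0.
  - exact: sub_ideal_adjoin.
exists (e + e'); first by rewrite linD de' addrC subrK.
move=> x cx; rewrite scalerDr ce // add0r; apply: ce'.
exact: sub_ideal_adjoin.
Qed.

(** Descending induction on [i], starting where the resolution is zero. *)
Lemma ext_vanish N : (forall i, (N < i)%N -> forall x : I i, x = 0) ->
  forall i, ext_van i.
Proof.
move=> HN; suff H k i : (N < i + 2 + k)%N -> ext_van i.
  by move=> i; apply: (H N); rewrite -[X in (X < _)%N]add0n ltn_add2r addn2.
elim: k i => [|k IH] i Ni; last first.
  by apply: ext_van_step; apply: IH; rewrite addSn addSn -addnS.
move=> c b z _ _ _ _ _; exists 0; last by move=> x _; rewrite scaler0.
by rewrite lin0; apply/esym/HN; rewrite addn0 addn2 in Ni.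
Qed.

Section Modulo.
Variable a : R.
Hypotheses (ra : GRing.lreg a) (aC : forall c : C, a *: c = 0 -> c = 0).

(** The kernel of [d 0] is [C], which has no [a]-torsion, so [d 0] is injective on the [a]-torsion
    of [I 0]; its inverse there extends to [I 1]. *)
Lemma torsion_retract : exists h : {linear I 1%N -> I 0%N},
  forall e, a *: e = 0 -> h (d 0%N e) = e.
Proof.
pose G (y : I 1%N) (e : I 0%N) := d 0%N e = y /\ a *: e = 0.
have [||h hP] := @inj_ext_rel _ _ _ G (@injI 0%N).
- split; first by rewrite /G lin0 scaler0.
  move=> b _ _ v w [<- av] [<- aw]; rewrite /G linP; split=> //.
  by rewrite scalerDr aw addr0 scalerA mulrC -scalerA av scaler0.
- move=> e [/ex0[c <-]]; rewrite -linZ -[RHS](lin0 eta).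
  by rewrite -(lin0 eta) => /eta_inj/aC ->.
by exists h => e ae; apply: hP.
Qed.

(* The sequence 0 -> I0[a] -> ker(d 1)[a] -> C/aC -> 0 is split by the
   retraction h; sigma is the resulting section. *)
Lemma exists_section : exists (h : {linear I 1%N -> I 0%N}) (sigma : C -> I 1%N),
  [/\ forall e, a *: e = 0 -> h (d 0%N e) = e,
      forall r x y, sigma (r *: x + y) = r *: sigma x + sigma y,
      forall x, sigma x = 0 <-> exists c, x = a *: c,
      forall x, h (sigma x) = 0 /\ d 1%N (sigma x) = 0 &
      forall z, d 1%N z = 0 -> a *: z = 0 -> exists c,
        a *: h z = 0 /\ sigma c = z - d 0%N (h z)].
Proof.
have [h hP] := torsion_retract.
have /choice[w wP] (c : C) : exists w, eta c = a *: w.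
  exact: inj_divisible (@injI 0%N) ra.
(* The connecting map: [a] kills [d 0 (w c)] because [a w c = eta c]. The second term removes the
   dependence on the choice of [w c], as [sE] shows. *)
pose sigma c := d 0%N (w c) - d 0%N (h (d 0%N (w c))).
have hdw c : a *: h (d 0%N (w c)) = 0 by rewrite -!linZ -wP deta lin0.
have sE c v : eta c = a *: v -> sigma c = d 0%N v - d 0%N (h (d 0%N v)).
  move=> cv; have ae : a *: (w c - v) = 0 by rewrite scalerBr -wP -cv subrr.
  rewrite /sigma; have -> : w c = v + (w c - v) by rewrite addrC subrK.
  move: (w c - v) ae => e ae.
  rewrite (linD (d 0%N)) (linD h) (hP e ae) (linD (d 0%N)).
  by rewrite opprD addrACA subrr addr0.
have hs x : h (sigma x) = 0 by rewrite /sigma linB /= (hP _ (hdw x)) subrr.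
have sD r x y : sigma (r *: x + y) = r *: sigma x + sigma y.
  have -> := @sE (r *: x + y) (r *: w x + w y).
    by rewrite /sigma (linP (d 0%N)) (linP h) (linP (d 0%N)) scalerBr opprD addrACA.
  by rewrite linP /= !wP scalerDr !scalerA mulrC.
exists h, sigma; split=> // [x|x|z dz az]; last 2 first.
- by split=> //; rewrite linB /= !dd subrr.
- have [v dv] := exd dz.
  have [|c cE] := @ex0 (a *: v); first by rewrite linZ dv.
  exists c; split; first by rewrite -linZ az lin0.
  by rewrite (sE _ _ cE) dv.
- split=> [s0|[c ->]]; last first.
    have -> := @sE (a *: c) (eta c); last by rewrite linZ.
    by rewrite deta (lin0 h) (lin0 (d 0%N)) subr0.
  have [|c cE] := @ex0 (w x - h (d 0%N (w x))); first by rewrite linB.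
  exists c; apply: eta_inj; rewrite linZ cE scalerBr hdw subr0 -wP.
  by [].
Qed.

(** Composing [G] with [sigma] gives a map to [I 1], extended as multiplication by some [e] killed
    by [a]. The coboundary of [e] is killed by the domain of the map, so the vanishing of [Ext^2]
    replaces [e] by an [a]-torsion cocycle, and [sz] turns this into the required [y]. *)
Lemma resolution_ext_prop : ext_van 0%N -> ext_prop C a.
Proof.
move=> EV G [G0 GD] Ga; have [h [sigma [hP sD s0 hds sz]]] := exists_section.
have hs x := (hds x).1; have ds x := (hds x).2.
have sig0 : sigma 0 = 0 by apply/s0; exists 0; rewrite scaler0.
have sZ r x : sigma (r *: x) = r *: sigma x.
  by have := sD r x 0; rewrite !addr0 sig0 addr0.
have sN x y : sigma (x - y) = sigma x - sigma y.
  by rewrite addrC -scaleN1r sD scaleN1r addrC.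
have sa x : a *: sigma x = 0 by rewrite -sZ; apply/s0; exists x.
pose F x (e : I 1%N) := exists x0 c r, [/\ G x0 c, x = x0 + a * r & e = sigma c].
have [||e eP] := @inj_ext_ideal _ _ F (@injI 1%N).
- split; first by exists 0, 0, 0; split=> //; ring.
  move=> k _ _ _ _ [x [c [r [Gx -> ->]]]] [y [c' [r' [Gy -> ->]]]].
  exists (k * x + y), (k *: c + c'), (k * r + r'); split; first exact: GD.
    by rewrite /GRing.scale /=; ring.
  by rewrite sD.
- move=> _ [x [c [r [Gx x0 ->]]]]; apply/s0; apply: (Ga (- r)).
  by rewrite mulrN (_ : - _ = x) //; apply/eqP; rewrite eq_sym -addr_eq0 -x0.
have Fe x c : G x c -> sigma c = x *: e.
  by move=> Gx; apply: eP; exists x, c, 0; split=> //; ring.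
have ae : a *: e = 0.
  by apply/esym/eP; exists 0, 0, 1; split=> //; ring.
have Hc : is_ideal [set x | exists e, F x e].
  split; first by exists 0, 0, 0, 0; split=> //; ring.
  move=> k _ _ [_ [x [c [r [Gx -> _]]]]] [_ [y [c' [r' [Gy -> _]]]]].
  exists (sigma (k *: c + c')), (k * x + y), (k *: c + c'), (k * r + r').
  by split=> //; [exact: GD | ring].
have [||x [_ [x0 [c [r [Gx -> _]]]]]|e' de' ce'] := EV _ a (d 1%N e) Hc _ ra.
- by exists 0, 0, 0, 1; split=> //; ring.
- exact: dd.
- by rewrite -linZ scalerDl -(Fe _ _ Gx) mulrC -scalerA ae scaler0 addr0 ds.
have ce1 x c : G x c -> sigma c = x *: (e - e').
  move=> Gx; rewrite scalerBr -(Fe _ _ Gx) ce' ?subr0 //.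
  by exists (sigma c), x, c, 0; split=> //; ring.
have ae' : a *: (e - e') = 0.
  rewrite scalerBr ae ce' ?subr0 //.
  by exists 0, 0, 0, 1; split=> //; ring.
have [|y [_ sy]] := sz (e - e') _ ae'; first by rewrite linB de' subrr.
exists y => x c Gx; apply/s0.
by rewrite sN sZ sy scalerBr -(ce1 _ _ Gx) -!linZ -(ce1 _ _ Gx) hs lin0 subr0 subrr.
Qed.
(** This is [Ext^1 (k, C) = Hom (k, C/aC)]. A cocycle is given by an element [z] of [ker (d 1)]
    killed by all nonunits, and [z - d 0 (h z)] is [sigma] of a socle element of [C/aC]; conversely,
    [sigma] maps socle elements to such cocycles. *)
Lemma resolution_soc_prop (E : lmodType R)
    (cl : {linear residue_field R -> I 1%N} -> E) :
  a \isn't a GRing.unit ->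
  (forall k (f g h : {linear residue_field R -> I 1%N}),
     cocycle d f -> cocycle d g ->
     (forall x, h x = k *: f x + g x) -> cl h = k *: cl f + cl g) ->
  (forall e, exists2 f : {linear residue_field R -> I 1%N}, cocycle d f & cl f = e) ->
  (forall f : {linear residue_field R -> I 1%N}, cocycle d f ->
     cl f = 0 <-> coboundary d f) ->
  has_residue_dim E 1 -> soc_prop C a.
Proof.
move=> ua clD cl_onto cl0 [mE [b [bgen bfree]]].
have [h [sigma [hP sD s0 hds sz]]] := exists_section.
have hs x := (hds x).1; have ds x := (hds x).2.
have sig0 : sigma 0 = 0 by apply/s0; exists 0; rewrite scaler0.
have sZ r x : sigma (r *: x) = r *: sigma x.
  by have := sD r x 0; rewrite !addr0 sig0 addr0.
have sN x y : sigma (x - y) = sigma x - sigma y.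
  by rewrite addrC -scaleN1r sD scaleN1r addrC.
have cocyc (z : I 1%N) (f : {linear residue_field R -> I 1%N}) :
    f (residue 1) = z -> d 1%N z = 0 -> cocycle d f.
  move=> fz dz x; have [r <-] := residue_surj x.
  by rewrite -residue_scale_one !linZ fz dz scaler0.
have [f0 co0 f0E] := cl_onto (b 0).
pose z0 := f0 (residue 1).
have mz0 x : x \isn't a GRing.unit -> x *: z0 = 0.
  by move=> ux; rewrite -linZ residue_scale_one residue_eq0 // lin0.
have dz0 : d 1%N z0 = 0 by apply: co0.
have [t [_ st]] := sz z0 dz0 (mz0 _ ua).
have mh x : x \isn't a GRing.unit -> x *: h z0 = 0.
  by move=> ux; rewrite -linZ mz0 // lin0.
exists t; split.
- move=> /s0; rewrite st => /eqP; rewrite subr_eq0 => /eqP z0E.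
  have [g gE] := residue_map mh.
  have /(cl0 _ co0) clf0 : coboundary d f0.
    exists g => x; have [r <-] := residue_surj x.
    by rewrite -residue_scale_one !linZ gE -z0E.
  have := bfree (fun=> 1); rewrite big_ord1 scale1r -f0E clf0 => /(_ erefl 0).
  by rewrite /in_mem /= /maxideal unitr1.
- by move=> x ux; apply/s0; rewrite sZ st scalerBr mz0 // -linZ mh // lin0 subr0.
move=> y my.
have msy x : x \isn't a GRing.unit -> x *: sigma y = 0.
  by move=> /my ?; rewrite -sZ; apply/s0.
have [fy fyE] := residue_map msy.
have coy : cocycle d fy by apply: cocyc fyE (ds y).
have [k] := bgen (cl fy); rewrite big_ord1 -f0E; move: (k 0) => {}k clfy.
have mg x : x \isn't a GRing.unit -> x *: (- k *: z0 + sigma y) = 0.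
  by move=> ux; rewrite scalerDr msy // scalerA mulrC -scalerA mz0 // scaler0 addr0.
have [g gE] := residue_map mg.
have gfy x : g x = - k *: f0 x + fy x.
  have [r <-] := residue_surj x.
  rewrite -residue_scale_one (linZ g) (linZ f0) (linZ fy) gE fyE -/z0.
  by rewrite scalerDr !scalerA (mulrC r).
have cog : cocycle d g.
  by apply: cocyc gE _; rewrite linP dz0 ds scaler0 addr0.
have /(cl0 _ cog)[u uE] : cl g = 0.
  by rewrite (clD _ _ _ _ co0 coy gfy) clfy scaleNr addNr.
have au : a *: u (residue 1) = 0.
  by rewrite -linZ residue_scale_one residue_eq0 // lin0.
have := uE (residue 1); rewrite gE => du.
have hu : u (residue 1) = - k *: h z0 by rewrite -(hP _ au) -du linP hs addr0.
have /s0[c cE] : sigma (y - k *: t) = 0.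
  rewrite sN sZ st scalerBr; have -> : sigma y = d 0%N (u (residue 1)) + k *: z0.
    by rewrite -du scaleNr addrAC addNr add0r.
  by rewrite hu (linZ (d 0%N)) scaleNr [X in X - _]addrC subrr.
by exists k, c; rewrite -cE addrC subrK.
Qed.
End Modulo.

End Resolution.

(** * Uniqueness of Krull dimension and depth *)

Section DimDepth.

Lemma prime_chain_le (R : comUnitRingType) m n :
  (m <= n)%N -> prime_chain R n -> prime_chain R m.
Proof.
move=> mn [P [Pp Pi]]; exists P; split=> i im.
  by apply: Pp; apply: leq_trans im mn.
by apply: Pi; apply: leq_trans im mn.
Qed.

Lemma krull_dim_inj (R : comUnitRingType) m n :
  has_krull_dim R m -> has_krull_dim R n -> m = n.
Proof.
move=> [cm ncm] [cn ncn]; apply/eqP; rewrite eqn_leq; apply/andP; split.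
  by rewrite leqNgt; apply/negP => nm; apply: ncn; apply: prime_chain_le cm.
by rewrite leqNgt; apply/negP => nm; apply: ncm; apply: prime_chain_le cn.
Qed.

Variable R : localRingType.

Lemma seq_submodP (M : lmodType R) rs (x : M) : @seq_submod R M rs x <->
  exists y : nat -> M, x = \sum_(0 <= i < size rs) rs`_i *: y i.
Proof.
split=> [[y ->]|[y ->]]; last first.
  by exists (fun i => y i); rewrite big_mkord.
exists (fun i => if insub i is Some j then y j else 0); rewrite big_mkord.
by apply: eq_bigr => i _; rewrite valK.
Qed.

(** Depth [n] explicitly excludes only regular sequences of length [n + 1]; truncation excludes all
    longer ones. *)
Lemma regular_seq_take (M : lmodType R) rs k :
  (k <= size rs)%N -> regular_seq M rs -> regular_seq M (take k rs).
Proof.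
move=> ks [rs_m rs_r [x nx]]; have sk : size (take k rs) = k by rewrite size_takel.
split; rewrite ?sk.
- by move=> i ik; rewrite nth_take //; apply: rs_m; apply: leq_trans ik ks.
- move=> i y ik; rewrite nth_take // take_takel; last exact: ltnW.
  by apply: rs_r; apply: leq_trans ik ks.
exists x => /seq_submodP[y xE]; apply: nx; apply/seq_submodP.
exists (fun i => if (i < k)%N then y i else 0).
rewrite (big_cat_nat _ ks) //= [X in _ + X](_ : _ = 0).
  by rewrite addr0 xE sk; apply: eq_big_nat => i /andP[_ ik]; rewrite ik nth_take.
by rewrite big_nat big1 // => i /andP[ki _]; rewrite ltnNge ki scaler0.
Qed.

Lemma depth_inj (M : lmodType R) m n : has_depth M m -> has_depth M n -> m = n.
Proof.
have H k l : has_depth M k -> has_depth M l -> (k <= l)%N.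
  move=> [[rs [srs rrs]] _] [_ nl]; rewrite leqNgt; apply/negP => lk; apply: nl.
  exists (take l.+1 rs); rewrite size_takel ?srs //; split=> //.
  by apply: regular_seq_take => //; rewrite srs.
by move=> Mm Mn; apply/eqP; rewrite eqn_leq !H.
Qed.

End DimDepth.

(** * The elementary conditions on canonical ideals, and their necessity *)

Section IdealProps.
Variable R : comUnitRingType.

(* [ext_prop] and [soc_prop] for the module [J], in terms of elements of [R]. *)
Definition ext_ideal (J : set R) (a : R) : Prop :=
  forall G : R -> R -> Prop, @linear_rel R R^o R^o G ->
    (forall x v, G x v -> J v) ->
    (forall r v, G (a * r) v -> dilate a J v) ->
    exists2 y, J y & forall x v, G x v -> dilate a J (v - x * y).

Definition soc_ideal (J : set R) (a : R) : Prop :=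
  exists t, [/\ J t, ~ dilate a J t,
    forall x, x \isn't a GRing.unit -> dilate a J (x * t) &
    forall y, J y -> (forall x, x \isn't a GRing.unit -> dilate a J (x * y)) ->
      exists s j, J j /\ y = s * t + a * j].

End IdealProps.

Section CanonicalIdeal.
Variable R : localRingType.

Hypotheses (HR : noetherian R) (Hdim : has_krull_dim R 1).

(** The finite resolution yields [ext_prop]; the resolution inside [is_Ext], possibly a different
    one, yields [soc_prop]. Depth and dimension agree, so the degree of this [Ext] is [1]. *)
Lemma canonical_module_props (C : lmodType R) (a : R) :
  canonical_module C -> GRing.lreg a -> a \isn't a GRing.unit ->
  (forall c : C, a *: c = 0 -> c = 0) -> ext_prop C a /\ soc_prop C a.
Proof.
move=> [[_ [k [dimk depk]]] [t [E [dept ExtE dimE]]] [I [eta [d [res [N HN]]]]]].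
move=> ra ua aC; have k1 := krull_dim_inj dimk Hdim; subst k.
have t1 := depth_inj dept depk; subst t.
split.
  apply: (resolution_ext_prop res) => //.
  by apply: (ext_vanish HR _ res HN); case: Hdim.
have [I' [eta' [d' [res' [cl [clD cl_onto cl0]]]]]] := ExtE.
exact: (resolution_soc_prop res' ra aC ua clD cl_onto cl0 dimE).
Qed.

Lemma canonical_ideal_props (J : set R) (a : R) : canonical_ideal J ->
  GRing.lreg a -> a \isn't a GRing.unit -> ext_ideal J a /\ soc_ideal J a.
Proof.
move=> [_ [C [f [HC fI ->]]]] ra ua.
have [|extC [t [nt mt tP]]] := canonical_module_props HC ra ua.
  move=> c ac0; apply: fI; rewrite lin0; apply: (lreg_eq0 ra).
  by have := lin0 f; rewrite -ac0 linZ.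
have dilf c : dilate a (range f) (f c) <-> exists c', c = a *: c'.
  split=> [[_ [c' _ <-] fc]|[c' ->]]; last by exists (f c'); [exists c' | rewrite linZ].
  by exists c'; apply: fI; rewrite linZ fc.
split.
  move=> G [G0 GD] GJ Ga.
  have [||y yP] := @extC (fun x c => G x (f c)).
  - split; first by rewrite lin0.
    by move=> k x x' c c' Gx Gx'; rewrite linP; apply: GD.
  - by move=> r c /Ga /dilf.
  exists (f y); first by exists y.
  move=> x v Gxv; have [c _ cE] := GJ _ _ Gxv; rewrite -cE in Gxv *.
  have -> : f c - x * f y = f (c - x *: y) by rewrite linB linZ.
  by apply/dilf; apply: yP.
exists (f t); split; first by exists t.
- by move=> /dilf.
- move=> x ux; have -> : x * f t = f (x *: t) by rewrite linZ.
  by apply/dilf; apply: mt.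
move=> _ [y _ <-] my; have [|s [c yE]] := tP y.
  by move=> x /my mx; apply/dilf; rewrite linZ.
by exists s, (f c); split; [exists c | rewrite yE linP linZ].
Qed.

End CanonicalIdeal.

(** * Baer's criterion and rings of fractions *)

Section Baer.
Variable R : comUnitRingType.

Definition baer_prop (E : lmodType R) : Prop :=
  forall G : R -> E -> Prop, @linear_rel R R^o E G ->
    (forall e, G 0 e -> e = 0) -> exists e, forall x v, G x v -> v = x *: e.

(** Zorn's lemma for graphs of partial extensions. A maximal one is total: Baer's condition on the
    ideal of all [x] with [x b] in the domain extends it to [b]. *)
Lemma baer (E : lmodType R) : baer_prop E -> injective_module E.
Proof.
move=> HE A B f g fI.
pose good (H : set (B * E)) := [/\ linear_rel (fun b e => H (b, e)),
  forall e, H (0, e) -> e = 0 & forall x, H (f x, g x)].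
pose P (H : set (B * E)) := H = set0 \/ good H.
have [|H [PH maxH]] := @Zorn_bigcup _ P.
  move=> F FP Ftot; have [[H0 FH0 nH0]|allE] := pselect (exists2 H, F H & H <> set0).
    right; have gd H : F H -> H <> set0 -> good H by move=> /FP[].
    have gdx H x : F H -> H x -> good H.
      by move=> FH Hx; apply: gd => // HE0; rewrite HE0 in Hx.
    have [[H00 _] _ H0fg] := gd _ FH0 nH0.
    split.
    - split; first by exists H0.
      move=> a x y v w [X FX Xx] [Y FY Yy].
      have [XY|YX] := Ftot _ _ FX FY.
        have [[_ YD] _ _] := gdx _ _ FY Yy.
        by exists Y => //; apply: YD => //; apply: XY.
      have [[_ XD] _ _] := gdx _ _ FX Xx.
      by exists X => //; apply: XD => //; apply: YX.
    - by move=> e [X FX Xe]; have [_ Xf _] := gdx _ _ FX Xe; apply: Xf.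
    - by move=> x; exists H0.
  left; apply/seteqP; split=> // x [X FX Xx]; apply: allE; exists X => // X0.
  by rewrite X0 in Xx.
have {PH}[[H0 HD] Hf Hfg] : good H.
  case: PH => // H0.
  pose K : set (B * E) := [set p | exists x, p = (f x, g x)].
  case: (maxH K); first rewrite H0.
    by split=> // /(_ (f 0, g 0)); apply; exists 0.
  right; split; last by move=> x; exists x.
  - split; first by exists 0; rewrite !lin0.
    move=> a _ _ _ _ [x [-> ->]] [y [-> ->]].
    by exists (a *: x + y); rewrite !linP.
  - by move=> e [x [/esym fx ->]]; rewrite (fI x 0) ?lin0.
have Htot b : exists e, H (b, e).
  have [||e eP] := HE (fun x v => H (x *: b, v)).
  - split; first by rewrite scale0r.
    by move=> a x y v w Hx Hy; rewrite scalerDl -scalerA; apply: HD.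
  - by move=> e; rewrite scale0r; apply: Hf.
  pose K : set (B * E) := [set p | exists x q, H q /\ p = (x *: b + q.1, x *: e + q.2)].
  exists e; suff : K `<=` H.
    by apply; exists 1, (0, 0); rewrite /= !scale1r !addr0.
  have HK : H `<=` K.
    by move=> [c v] Hq; exists 0, (c, v); rewrite /= !scale0r !add0r.
  apply: contrapT => nKH; apply: (maxH K) => //; right; split.
  - split; first exact: HK.
    move=> a _ _ _ _ [x [[c v] [Hq [-> ->]]]] [y [[c' v'] [Hq' [-> ->]]]].
    exists (a * x + y), (a *: c + c', a *: v + v'); split; first exact: HD.
    by rewrite /= !scalerDl !scalerDr !scalerA; congr (_, _); rewrite addrACA.
  - move=> v [x [[c w] [Hq [/esym /= xc ->]]]].
    have cE : c = - x *: b by rewrite scaleNr; apply/eqP; rewrite -addr_eq0 addrC xc.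
    have -> : w = - x *: e by apply: eP; rewrite -cE.
    by rewrite scaleNr subrr.
  - by move=> x; apply: HK.
have [h hP] := choice Htot.
have uniq b e : H (b, e) -> h b = e.
  by move=> He; apply: (@linear_rel_fun _ _ _ (fun b e => H (b, e)) b).
have lh : linear h by move=> a x y; apply: uniq; apply: HD.
by exists (mklin lh) => x; rewrite mklinE; apply: uniq.
Qed.

Lemma linear_rel_gen (E : lmodType R) (G : R -> E -> Prop) : noetherian R ->
  @linear_rel R R^o E G -> (forall e, G 0 e -> e = 0) ->
  exists r (x : 'I_r -> R) (v : 'I_r -> E), (forall i, G (x i) (v i)) /\
    forall x0 v0, G x0 v0 -> exists c : 'I_r -> R,
      x0 = \sum_i c i * x i /\ v0 = \sum_i c i *: v i.
Proof.
move=> HR HG Gf; have [G0 GD] := HG.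
have HD : is_ideal [set x | exists v, G x v].
  split; first by exists 0.
  by move=> k x y [v Gv] [w Gw]; exists (k *: v + w); apply: GD.
have [r [x Dx]] := HR _ HD.
have /choice[v vP] i : exists v, G (x i) v.
  suff : [set x | exists v, G x v] (x i) by [].
  rewrite Dx; exists (fun l => (l == i)%:R).
  rewrite (bigD1 i) //= eqxx mul1r big1 ?addr0 //.
  by move=> l /negbTE ->; rewrite mul0r.
exists r, x, v; split=> // x0 v0 Gx0.
have : [set x | exists v, G x v] x0 by exists v0.
rewrite Dx => -[c cE]; exists c; split=> //.
apply: (linear_rel_fun HG Gf Gx0); rewrite cE.
have GS (s : seq 'I_r) : G (\sum_(i <- s) c i * x i) (\sum_(i <- s) c i *: v i).
  elim: s => [|i s IH]; first by rewrite !big_nil.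
  by rewrite !big_cons; apply: GD.
exact: GS.
Qed.

End Baer.

Section Fractions.
Variables (R : comUnitRingType) (a : R).
Hypothesis (ra : GRing.lreg a).

(* [R[X] / (aX - 1, J)] with [J] taken as a submodule of constants, not as an
   ideal of [R[X]]: this is [R[1/a] / J], and [R[1/a]] itself for [J = 0]. *)
Definition frac_rel (J : set R) : {poly R} -> Prop :=
  fun p => exists j q, J j /\ p = j%:P + (a *: 'X - 1) * q.

Lemma frac_relP J : is_ideal J -> @is_submod R {poly R} (frac_rel J).
Proof.
move=> HJ; split.
  by exists 0, 0; split; [exact: ideal0 | rewrite polyC0 mulr0 addr0].
move=> k _ _ [j [q [Jj ->]]] [j' [q' [Jj' ->]]].
exists (k * j + j'), (k *: q + q'); split; first exact: HJ.2.
rewrite polyCD polyCM scalerDr mulrDr -!mul_polyC.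
by ring.
Qed.

Lemma zero_ideal : is_ideal [set 0 : R].
Proof. by split=> // k x y -> ->; rewrite /=; ring. Qed.

(** A common denominator: modulo [aX - 1], the constant [c] equals [a ^ (n + 1) c X ^ (n + 1)]. *)
Lemma poly_frac (p : {poly R}) :
  exists x n q, p = x *: 'X^n + (a *: 'X - 1) * q.
Proof.
elim/poly_ind: p => [|p c [x [n [q pE]]]].
  by exists 0, 0%N, 0; rewrite scale0r mulr0 addr0.
have [S SE] : exists S, (a *: 'X) ^+ n.+1 - 1 = (a *: 'X - 1) * S :> {poly R}.
  by eexists; apply: subrX1.
exists (x + a ^+ n.+1 * c), n.+1, (q * 'X - c%:P * S).
have -> : (a *: 'X - 1) * (q * 'X - c%:P * S) =
    (a *: 'X - 1) * q * 'X - c%:P * ((a *: 'X - 1) * S) by ring.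
rewrite -SE pE exprZn !exprS -!mul_polyC !polyCD !polyCM.
by ring.
Qed.

(* [a ^ N p(1 / a)], for [p] of degree at most [N]. *)
Definition hev N (p : {poly R}) := \sum_(i < N.+1) a ^+ (N - i) * p`_i.

Lemma hevD N p q : hev N (p + q) = hev N p + hev N q.
Proof.
by rewrite /hev -big_split; apply: eq_bigr => i _; rewrite coefD mulrDr.
Qed.

Lemma hev_monom N x n : (n <= N)%N -> hev N (x *: 'X^n) = a ^+ (N - n) * x.
Proof.
move=> nN; rewrite /hev (bigD1 (Ordinal (nN : n < N.+1)%N)) //=.
rewrite coefZ coefXn eqxx mulr1 big1 ?addr0 // => i ni.
rewrite coefZ coefXn -val_eqE /= in ni *.
by rewrite (negbTE ni) !mulr0.
Qed.

(** The factor [aX - 1] vanishes at [1 / a]: the sum telescopes, and the size bound removes its last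
    term. *)
Lemma hev_rel N (q : {poly R}) : (size q <= N.+1)%N -> hev N.+1 ((a *: 'X - 1) * q) = 0.
Proof.
move=> sq; rewrite /hev.
have cE i : ((a *: 'X - 1) * q)`_i = (if i is j.+1 then a * q`_j else 0) - q`_i.
  rewrite mulrBl mul1r coefB -scalerAl coefZ coefXM.
  by case: i => //=; rewrite mulr0.
under eq_bigr do rewrite cE mulrBr.
rewrite sumrB [X in X - _]big_ord_recl mulr0 add0r.
rewrite [X in _ - X]big_ord_recr /= (nth_default 0 sq) mulr0.
rewrite addr0 -sumrB big1 // => i _.
rewrite subSS subSn; last by rewrite -ltnS.
by rewrite exprS; ring.
Qed.

Section FracJ.
Variable (J : set R) (HJ : is_ideal J).

Definition fracm := quotm (Submodule (frac_relP HJ)).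

HB.instance Definition _ := GRing.Lmodule.on fracm.

(* The class of [x / a ^ n]. *)
Definition fr x n : fracm := quotpi (Submodule (frac_relP HJ)) (x *: 'X^n).

Lemma quotpi_mulX (p : {poly R}) k :
  quotpi (Submodule (frac_relP HJ)) (a ^+ k *: ('X^k * p)) =
  quotpi (Submodule (frac_relP HJ)) p.
Proof.
elim: k => [|k IH]; first by rewrite !expr0 scale1r mul1r.
rewrite -IH; apply/quotpi_eq; exists 0, (a ^+ k *: ('X^k * p)).
split; first exact: ideal0.
by rewrite polyC0 -!mul_polyC !exprS polyCM; ring.
Qed.

Lemma fr_shift x n k : fr x n = fr (a ^+ k * x) (n + k).
Proof.
rewrite /fr -(quotpi_mulX _ k); congr (quotpi _ _).
by rewrite -!mul_polyC polyCM exprD; ring.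
Qed.

Lemma fr_lin k x y n : fr (k * x + y) n = k *: fr x n + fr y n.
Proof. by rewrite /fr -quotpiZ -quotpiD scalerA scalerDl. Qed.

Lemma fr0 n : fr 0 n = 0.
Proof. by rewrite /fr scale0r; exact: (lin0 (quotpi _)). Qed.

Lemma frZ k x n : fr (k * x) n = k *: fr x n.
Proof. by rewrite -[k * x]addr0 fr_lin fr0 addr0. Qed.

Lemma frB x y n : fr (x - y) n = fr x n - fr y n.
Proof. by rewrite addrC -mulN1r fr_lin scaleN1r addrC. Qed.

Lemma frD x y n : fr (x + y) n = fr x n + fr y n.
Proof. by rewrite -[x]mul1r fr_lin scale1r mul1r. Qed.

Lemma fr_surj q : exists x n, q = fr x n.
Proof.
have [p <-] := quotpi_repr q; have [x [n [r ->]]] := poly_frac p.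
exists x, n; apply/quotpi_eq; exists 0, r; split; first exact: ideal0.
by rewrite polyC0 add0r addrC addKr.
Qed.

(** Clearing denominators with [hev] turns a relation between polynomials into one in [R], where
    powers of [a] cancel. *)
Lemma fr_eq0 x n : fr x n = 0 <-> dilate (a ^+ n) J x.
Proof.
split=> [/quotpi_eq0[j [q [Jj xE]]]|[j Jj ->]].
  exists j => //; pose N := maxn n (size q).
  have : hev N.+1 (x *: 'X^n) = a ^+ N.+1 * j.
    rewrite xE hevD hev_rel ?addr0; last first.
      by apply: leq_trans (leqnSn _); apply: leq_maxr.
    by rewrite -[j%:P]mulr1 mul_polyC -(expr0 'X) hev_monom ?subn0.
  rewrite hev_monom; last by apply: leq_trans (leqnSn _); apply: leq_maxl.
  have nN : (n <= N.+1)%N by apply: leq_trans (leqnSn _); apply: leq_maxl.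
  rewrite -[in RHS](subnK nN) exprD -mulrA.
  exact: (lregX ra).
have <- := fr_shift j 0 n; apply/quotpi_eq0.
by exists j, 0; split=> //; rewrite expr0 mulr0 addr0 alg_polyC.
Qed.

Lemma fr_inj x n : J = [set 0] -> fr x n = 0 -> x = 0.
Proof.
by move=> J0 /fr_eq0; rewrite J0 => -[_ -> ->]; rewrite mulr0.
Qed.

Lemma fr_div x n k : fr x n = a ^+ k *: fr x (n + k).
Proof. by rewrite -frZ -fr_shift. Qed.

Lemma fr_common r (v : 'I_r -> fracm) :
  exists n, forall i, exists x, v i = fr x n.
Proof.
have /choice[f fP] i : exists xn : R * nat, v i = fr xn.1 xn.2.
  by have [x [n ->]] := fr_surj (v i); exists (x, n).
exists (\max_i (f i).2) => i; have ni := leq_bigmax (F := fun i => (f i).2) i.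
exists (a ^+ (\max_i (f i).2 - (f i).2) * (f i).1).
by rewrite fP (fr_shift _ _ (\max_i (f i).2 - (f i).2)) subnKC.
Qed.

End FracJ.

Lemma fracm_proj (J : set R) (HJ : is_ideal J) :
  exists p : {linear fracm zero_ideal -> fracm HJ},
    forall x n, p (fr zero_ideal x n) = fr HJ x n.
Proof.
pose S0 := Submodule (frac_relP zero_ideal); pose S := Submodule (frac_relP HJ).
pose p (q : quotm S0) : quotm S := quotpi S (quotrep q).
have pE u : p (quotpi S0 u) = quotpi S u.
  have : quotpi S0 (quotrep (quotpi S0 u)) = quotpi S0 u by exact: quotrepK.
  move=> /quotpi_eq[j [q [-> e]]]; apply/quotpi_eq; exists 0, q; split=> //.
  exact: ideal0.
have lp : linear p.
  move=> k x y; rewrite -(quotrepK x) -(quotrepK y) -quotpiZ -quotpiD !pE.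
  by rewrite quotpiD quotpiZ.
by exists (mklin lp) => x n; rewrite mklinE; apply: pE.
Qed.

Hypothesis (HR : noetherian R).

(* By the Artin-Rees argument for powers of [a], a map from an ideal [I] to [Q/J]
   kills [I \cap a ^ N R] for large [N], and it has values in
   [a ^ (- N) J / J = J / a ^ N J]. *)
Lemma fracm_baer (J : set R) (HJ : is_ideal J) : J a ->
  (forall n, (0 < n)%N -> ext_ideal J (a ^+ n)) -> baer_prop (fracm HJ).
Proof.
move=> Ja HE G HG Gf; have [G0 GD] := HG.
have [r [g [v [Gg gP]]]] := linear_rel_gen HR HG Gf.
have [n /choice[y yP]] := fr_common v.
have com x0 v0 : G x0 v0 -> exists z, v0 = fr HJ z n.
  move=> /gP[c [_ ->]]; exists (\sum_i c i * y i).
  rewrite (big_morph (fun z => fr HJ z n) (fun x y => frD HJ x y n) (fr0 HJ n)).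
  by apply: eq_bigr => i _; rewrite frZ -yP.
pose F k : set R := [set x | exists v0, G (a ^+ k * x) v0].
have FP k : is_ideal (F k).
  split; first by exists 0; rewrite mulr0.
  move=> b x z [v0 Gx] [v1 Gz]; exists (b *: v0 + v1).
  by rewrite mulrDr mulrCA; apply: GD.
have [|N0 N0P] := noetherian_stab HR FP.
  move=> k x [v0 Gx]; exists (a *: v0 + 0); rewrite exprS -mulrA -[_ * _]addr0.
  exact: GD.
(* If [a ^ N x] is in the domain, so is [a ^ N0 x]. The value at the latter has denominator [a ^ n],
   and the remaining factor [a ^ (n + 1)] takes it into [aR], which lies in [J]. *)
pose N := (N0 + n.+1)%N.
have [||||y0 Jy0 y0P] := HE N _ (fun x z => G x (fr HJ z N) /\ J z).
- by rewrite /N addnS.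
- split; first by rewrite fr0; split=> //; exact: ideal0.
  move=> k x x' z z' [Gx Jz] [Gx' Jz']; rewrite fr_lin.
  by split; [apply: GD | apply: HJ.2].
- by move=> x z [].
- move=> x z [Gx Jz]; apply/(fr_eq0 HJ).
  have [|v0 Gv0] := N0P N x; first by exists (fr HJ z N).
  have [w v0E] := com _ _ Gv0.
  have GN : G (a ^+ N * x) (a ^+ n.+1 *: v0).
    have := GD (a ^+ n.+1) _ _ _ _ Gv0 G0; rewrite !addr0 /GRing.scale /=.
    by rewrite mulrA -exprD addnC.
  rewrite (linear_rel_fun HG Gf Gx GN) v0E -frZ; apply/fr_eq0.
  by exists (w * a); [apply: ideal_mull | rewrite exprS; ring].
exists (fr HJ y0 N) => x v0 Gx.
have [z v0E] := com _ _ Gx.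
have v0N : v0 = fr HJ (a ^+ N0.+1 * z) N.
  by rewrite v0E (fr_shift _ _ _ N0.+1) /N addnC addnS addSn.
have Jz : J (a ^+ N0.+1 * z).
  by rewrite exprS -mulrA mulrC; apply: ideal_mull.
have Gx' : G x (fr HJ (a ^+ N0.+1 * z) N) by rewrite -v0N.
have /(fr_eq0 HJ) := y0P _ _ (conj Gx' Jz).
by rewrite frB (frZ HJ x) -v0N => /eqP; rewrite subr_eq0 => /eqP.
Qed.

Let Q := fracm zero_ideal.

Lemma frac_reg k (q : Q) : a ^+ k *: q = 0 -> q = 0.
Proof.
have [x [n ->]] := fr_surj q; rewrite -frZ => /fr_inj -/(_ erefl).
by move=> /(lreg_eq0 (lregX ra)) ->; rewrite fr0.
Qed.

Lemma frac_div k (q : Q) : exists q', q = a ^+ k *: q'.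
Proof.
by have [x [n ->]] := fr_surj q; exists (fr zero_ideal x (n + k)); apply: fr_div.
Qed.

(* Given [f : I -> Q], extending [f / a ^ n : I -> Q -> Q/J] yields [q_n] such
   that [f - q_n] maps [I] to [a ^ n J]; Krull's intersection theorem then
   finds a [q] with [f = q] on [I]. *)
Lemma frac_baer (J : set R) (HJ : is_ideal J) :
  (forall c, 1 - c * a \is a GRing.unit) -> baer_prop (fracm HJ) -> baer_prop Q.
Proof.
move=> aJ HE G HG Gf; have [G0 GD] := HG.
have [r [g [v [Gg gP]]]] := linear_rel_gen HR HG Gf.
have [p pE] := fracm_proj HJ.
have ker_p q : p q = 0 -> exists2 j, J j & q = fr zero_ideal j 0.
  have [x [n ->]] := fr_surj q; rewrite pE => /fr_eq0[j Jj ->].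
  by exists j => //; rewrite (fr_shift _ j 0 n).
have step n : exists q : Q, forall x v, G x v ->
    exists2 j, J j & v - x *: q = fr zero_ideal (a ^+ n * j) 0.
  pose H x w := exists v v', [/\ G x v, v = a ^+ n *: v' & w = p v'].
  have [||e eP] := HE H.
  - split; first by exists 0, 0; rewrite scaler0 lin0.
    move=> k x y _ _ [v1 [v1' [G1 e1 ->]]] [v2 [v2' [G2 e2 ->]]].
    exists (k *: v1 + v2), (k *: v1' + v2').
    rewrite (linP p); split=> //; first exact: GD.
    by rewrite e1 e2 scalerDr !scalerA mulrC.
  - move=> _ [v1 [v1' [/Gf -> /esym /frac_reg -> ->]]]; exact: lin0.
  have [x [m eE]] := fr_surj e; pose q : Q := fr zero_ideal x m.
  have pq : p q = e by rewrite pE.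
  exists (a ^+ n *: q) => y v1 Gy; have [v1' v1E] := frac_div n v1.
  have [|j Jj jE] := ker_p (v1' - y *: q).
    rewrite linB linZ pq; apply/eqP; rewrite subr_eq0; apply/eqP.
    by apply: eP; exists v1, v1'.
  exists j => //; rewrite frZ -jE scalerBr -v1E !scalerA.
  by congr (_ - _ *: _); ring.
have [q qP] := choice step.
have /choice[w wP] n : exists w : 'rV[R]_r,
    forall i, v i - g i *: q n = fr zero_ideal (a ^+ n * w 0 i) 0.
  have /choice[w wP] i : exists j, v i - g i *: q n = fr zero_ideal (a ^+ n * j) 0.
    by have [j _ jE] := qP n _ _ (Gg i); exists j.
  by exists (\row_i w i) => i; rewrite mxE.
(* The rows induced on the generators [g] by multiplication by an element of [Q]. The row
   [w n - a w (n + 1)] is induced by [(q (n + 1) - q n) / a ^ n]. *)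
pose U : set 'rV[R]_r := [set c | exists q : Q, forall i,
  fr zero_ideal (c 0 i) 0 = g i *: q].
have HU : is_submod U.
  split; first by exists 0 => i; rewrite mxE fr0 scaler0.
  move=> k x y [q1 H1] [q2 H2]; exists (k *: q1 + q2) => i.
  by rewrite !mxE fr_lin H1 H2 scalerDr !scalerA mulrC.
have [|q0 q0P] := @krull_chain _ _ U w a (@noeth_row _ HR r) HU aJ.
  move=> n; have [q' q'E] := frac_div n (q n.+1 - q n).
  exists q' => i; apply/eqP; rewrite -subr_eq0; apply/eqP/(@frac_reg n).
  rewrite scalerBr -frZ !mxE mulrBr mulrA -exprSr frB -!wP.
  rewrite scalerA [a ^+ n * g i]mulrC -scalerA -q'E scalerBr opprB.
  by rewrite [X in X - _]addrC addrA subrK subrr.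
exists (q 0%N + q0) => _ _ /gP[c [-> ->]].
rewrite scaler_suml; apply: eq_bigr => i _; rewrite -scalerA; congr (_ *: _).
have := wP 0%N i; rewrite expr0 mul1r q0P scalerDr => <-.
by rewrite addrC subrK.
Qed.

End Fractions.

(** * Criterion for canonical ideals *)

Section ShortResolution.
Variables (R : comUnitRingType) (E0 E1 : lmodType R) (p : {linear E0 -> E1}).

Definition short_mod (n : nat) : lmodType R :=
  match n with 0 => E0 | 1 => E1 | _ => 'rV[R]_0 end.

Lemma zero_linear (V W : lmodType R) : linear (fun _ : V => 0 : W).
Proof. by move=> k x y; rewrite scaler0 addr0. Qed.

Definition short_diff (n : nat) : {linear short_mod n -> short_mod n.+1} :=
  match n with 0 => p | n'.+1 => mklin (@zero_linear (short_mod n'.+1) 'rV[R]_0) end.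

Lemma short_resolution (C : lmodType R) (eta : {linear C -> E0}) :
  injective_module E0 -> injective_module E1 -> injective eta ->
  (forall y, p y = 0 <-> exists x, eta x = y) -> (forall z, exists y, p y = z) ->
  @injective_resolution R C short_mod eta short_diff.
Proof.
move=> inj0 inj1 ieta ex0 ex1; split=> //.
- case=> [|[|n]] //= A B f g fI; exists (mklin (@zero_linear _ _)) => x.
  by apply/rowP; case.
case=> [|n] y; split=> // _; by exists 0; apply/rowP; case.
Qed.

End ShortResolution.

Section Canonical.
Variable R : localRingType.
Hypotheses (HR : noetherian R) (Hdim : has_krull_dim R 1).
Variables (J : set R) (HJ : is_ideal J) (a : R).
Hypotheses (Ja : J a) (ra : GRing.lreg a) (ua : a \isn't a GRing.unit).
Hypotheses (extJ : forall n, (0 < n)%N -> ext_ideal J (a ^+ n)).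
Hypothesis (socJ : soc_ideal J a).

Let SJ : @submodule R R^o := Submodule (ideal_submod HJ).
Let C := subm SJ.

Lemma ideal_fin_gen : fin_gen C.
Proof.
have [n [g Jg]] := HR HJ.
have /choice[h hP] i : exists y : C, val y = g i :> R.
  apply: (@subm_ex _ _ SJ); rewrite /= Jg; exists (fun l => (l == i)%:R).
  rewrite (bigD1 i) //= eqxx mul1r big1 ?addr0 // => l /negbTE ->.
  by rewrite mul0r.
exists n, h => x; have : J (val x) by exact: (@subm_valP _ _ SJ).
rewrite Jg => -[c xE]; exists c; apply: val_inj; rewrite xE.
have lv : linear (val : C -> R^o) by exact: linearP.
rewrite -[val _]/(mklin lv _) linear_comb.
by apply: eq_bigr => i _; rewrite mklinE hP.
Qed.

Lemma seq_submod_nil (M : lmodType R) (x : M) : seq_submod [::] x <-> x = 0.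
Proof.
rewrite seq_submodP; split=> [[y ->]|->]; first by rewrite big_nil.
by exists (fun=> 0); rewrite big_nil.
Qed.

Lemma seq_submod1 (M : lmodType R) r (x : M) :
  seq_submod [:: r] x <-> exists y, x = r *: y.
Proof.
rewrite seq_submodP; split=> [[y ->]|[y ->]].
  by exists (y 0%N); rewrite big_nat1.
by exists (fun=> y); rewrite big_nat1.
Qed.

(** For the upper bound, an element [r1] regular on [C] is regular in [R], as [J] contains [a]. Then
    [C/r1 C] has a nonzero socle element, which every further candidate kills. *)
Lemma ideal_depth : has_depth C 1.
Proof.
have dilC r (x : C) : dilate r J (val x) <-> exists y, x = r *: y.
  split=> [[j Jj xE]|[y ->]]; last first.
    by exists (val y) => //; exact: (@subm_valP _ _ SJ).
  have [y yE] := @subm_ex _ _ SJ j Jj.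
  by exists y; apply: val_inj; rewrite xE -yE.
split.
  exists [:: a]; split=> //; split=> [[]|[]|] //=.
    move=> x _ /seq_submod_nil ax0; apply/seq_submod_nil.
    by apply: val_inj; apply: (lreg_eq0 ra); move/(congr1 val): ax0.
  have [t [Jt nt _ _]] := socJ; have [x xE] := @subm_ex _ _ SJ t Jt.
  by exists x => /seq_submod1 /dilC; rewrite xE.
move=> [[|r1 [|r2 [|? ?]]] [//= _ [rm rr [x nx]]]].
have r1C (y : C) : r1 *: y = 0 -> y = 0.
  move=> r1y; apply/seq_submod_nil; apply: (rr 0%N) => //.
  by apply/seq_submod_nil.
have rr1 : GRing.lreg r1.
  apply: mulrI0_lreg => y r1y; apply: (lreg_eq0 ra).
  have [z zE] := @subm_ex _ _ SJ (a * y) (ideal_mulr _ HJ Ja).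
  rewrite -zE (r1C z) //; apply: val_inj; rewrite /= zE.
  by rewrite [LHS]mulrCA r1y mulr0.
have nx1 : ~ dilate r1 J (val x).
  move=> /dilC[y xE]; apply: nx; apply/seq_submodP.
  exists (fun i => if i is 0%N then y else 0).
  by rewrite big_nat_recl // big_nat1 scaler0 addr0.
have [|r [nrx mrx]] := exists_socle_ideal HR Hdim.2 (dilateP r1 HJ) nx1 rr1.
  by exists (val x) => //; exact: (@subm_valP _ _ SJ).
apply: nrx; rewrite -[r * val x]/(val (r *: x)); apply/dilC/seq_submod1.
apply: (rr 1%N) => //; apply/seq_submod1/dilC; apply: mrx.
by have := rm 1%N isT.
Qed.

Let Q := fracm a (@zero_ideal R).
Let E := fracm a HJ.

Lemma ideal_resolution : exists (p : {linear Q -> E}) (eta : {linear C -> Q}),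
  injective_resolution (I := short_mod Q E) eta (short_diff p).
Proof.
have [p pE] := fracm_proj a HJ.
have le : linear (fun x : C => fr a (@zero_ideal R) (val x) 0).
  by move=> k x y; rewrite -fr_lin.
exists p, (mklin le); have HE : baer_prop E by exact: fracm_baer.
apply: short_resolution.
- by apply/baer/(frac_baer ra HR _ HE) => c; apply: unit_1B.
- exact: baer.
- move=> x y; rewrite !mklinE => /eqP; rewrite -subr_eq0 -frB => /eqP.
  move=> /(fr_inj ra) -/(_ erefl) /eqP; rewrite subr_eq0 => /eqP.
  exact: val_inj.
- move=> y; split=> [|[x <-]].
    have [x [n ->]] := fr_surj y; rewrite pE => /(fr_eq0 ra)[j Jj ->].
    have [z zE] := @subm_ex _ _ SJ j Jj.
    by exists z; rewrite mklinE zE (fr_shift _ _ j 0 n).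
  rewrite mklinE pE; apply/(fr_eq0 ra); exists (val x); rewrite ?expr0 ?mul1r //.
  exact: (@subm_valP _ _ SJ).
- by move=> z; have [x [n ->]] := fr_surj z; exists (fr a (@zero_ideal R) x n).
Qed.

Let socle_E : set E := [set w | forall x, x \isn't a GRing.unit -> x *: w = 0].

Lemma socle_submod : @is_submod R E socle_E.
Proof.
split=> [x _|k x y Hx Hy z uz]; first by rewrite scaler0.
by rewrite scalerDr Hy // scalerA mulrC -scalerA Hx // scaler0 addr0.
Qed.

Let T := subm (Submodule socle_submod).

Lemma fr1_eq0 x : fr a HJ x 1 = 0 <-> dilate a J x.
Proof. by rewrite (fr_eq0 ra) expr1. Qed.

(** The socle is killed by [a], so it lies in [a ^ (-1) J / J], a copy of [J/aJ], to which [socJ]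
    applies. *)
Lemma socle_frac (w : E) : socle_E w -> exists2 y, J y & w = fr a HJ y 1.
Proof.
move=> Tw; have [y [[|n] wE]] := fr_surj w.
  exists (a * y); first exact: ideal_mulr.
  by rewrite wE (fr_shift _ _ _ 0 1) expr1.
have := Tw a ua; rewrite wE -frZ => /(fr_eq0 ra)[j Jj].
rewrite exprS -mulrA => /ra ->; exists j => //.
by rewrite (fr_shift _ _ j 1 n).
Qed.

Lemma socle_dim : has_residue_dim T 1.
Proof.
have [t [Jt nt mt tP]] := socJ.
have Tt : socle_E (fr a HJ t 1).
  by move=> x ux; rewrite -frZ; apply/fr1_eq0; apply: mt.
have [e eE] := @subm_ex _ _ (Submodule socle_submod) _ Tt.
split=> [x w ux|].
  apply: val_inj; rewrite subm_valZ.
  exact: (@subm_valP _ _ (Submodule socle_submod) w).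
exists (fun=> e); split=> [w|k].
  have Tw := @subm_valP _ _ (Submodule socle_submod) w.
  have [y Jy wE] := socle_frac Tw.
  have [x ux|s [j [Jj yE]]] := tP y Jy.
    by apply/fr1_eq0; rewrite frZ -wE; apply: Tw.
  exists (fun=> s); rewrite big_ord1; apply: val_inj.
  rewrite subm_valZ eE wE yE fr_lin (_ : fr a HJ (a * j) 1 = 0) ?addr0 //.
  by apply/fr1_eq0; exists j.
rewrite big_ord1 => ke0 i; rewrite ord1 {i}; apply/negP => uk.
have : fr a HJ (k 0 * t) 1 = 0 by rewrite frZ -eE -subm_valZ ke0.
move=> /fr1_eq0[j Jj kt]; apply: nt; exists ((k 0)^-1 * j).
  exact: ideal_mull.
by rewrite mulrCA -kt mulKr.
Qed.

(** All maps from [k] to [Q/J] are cocycles, and they form the socle of [Q/J]; no nonzero one is a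
    coboundary, since [Hom (k, Q) = 0] by regularity of [a]. *)
Lemma ideal_Ext : is_Ext (residue_field R) C 1 T.
Proof.
have [p [eta res]] := ideal_resolution.
exists (short_mod Q E), eta, (short_diff p); split=> //.
have Hcl (f : {linear residue_field R -> E}) : exists y : T, val y = f (residue 1).
  apply: (@subm_ex _ _ (Submodule socle_submod)) => x ux.
  by rewrite -linZ residue_scale_one residue_eq0 // lin0.
have [cl clE] := choice Hcl.
exists cl; split.
- move=> k f g h _ _ fgh; apply: val_inj; rewrite clE fgh -!clE.
  by rewrite subm_valL.
- move=> e; have Te := @subm_valP _ _ (Submodule socle_submod) e.
  have [f fE] := residue_map Te; exists f => //.
  by apply: val_inj; rewrite clE fE.
move=> f _; split=> [clf0|[g gE]].
  have f1 : f (residue 1) = 0 by rewrite -clE clf0.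
  exists (mklin (@zero_linear _ _ _)) => x.
  have [r <-] := residue_surj x.
  by rewrite mklinE lin0 -residue_scale_one linZ f1 scaler0.
apply: val_inj; rewrite clE gE (_ : g (residue 1) = 0) ?lin0 //.
apply: (frac_reg (k := 1) ra); rewrite expr1 -linZ residue_scale_one.
by rewrite residue_eq0 // lin0.
Qed.

Lemma ideal_canonical : canonical_ideal J.
Proof.
split=> //.
have lv : linear (val : C -> R^o) by exact: linearP.
exists C, (mklin lv); split; last first.
- apply/seteqP; split=> [x Jx|_ [x _ <-]]; last exact: (@subm_valP _ _ SJ).
  by have [y yE] := @subm_ex _ _ SJ x Jx; exists y.
- exact: val_inj.
split.
- by split; [exact: ideal_fin_gen | exists 1%N; split=> //; exact: ideal_depth].
- by exists 1%N, T; split; [exact: ideal_depth | exact: ideal_Ext | exact: socle_dim].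
have [p [eta res]] := ideal_resolution.
exists (short_mod Q E), eta, (short_diff p); split=> //.
by exists 1%N => -[|[|n]] // _ x; apply/rowP; case.
Qed.

End Canonical.

(** * Canonical ideals of idealizations *)

(** Extending [G] by zero on [aR], one may assume that its domain contains [aR]. *)
Lemma ext_ideal_intro (R : comUnitRingType) (J : set R) (a : R) :
  (forall G : R -> R -> Prop, @linear_rel R R^o R^o G ->
    (forall x v, G x v -> J v) ->
    (forall r v, G (a * r) v -> dilate a J v) ->
    (forall r, G (a * r) 0) ->
    exists2 y, J y & forall x v, G x v -> dilate a J (v - x * y)) ->
  ext_ideal J a.
Proof.
move=> H G [G0 GD] GJ Ga.
have [||||y Jy yP] := H (fun x v => exists x0 t, G x0 v /\ x = x0 + a * t).
- split; first by exists 0, 0; split=> //; ring.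
  move=> k _ _ v w [x [t [Gx ->]]] [y [s [Gy ->]]].
  exists (k * x + y), (k * t + s); split; first exact: GD.
  by rewrite /GRing.scale /=; ring.
- by move=> x v [x0 [t [/GJ]]].
- move=> r v [x0 [t [Gx e]]]; apply: (Ga (r - t)).
  by rewrite mulrBr e addrK.
- by move=> r; exists 0, r; split=> //; ring.
exists y => // x v Gx; apply: yP.
by exists x, 0; split=> //; ring.
Qed.

Section Idealization.
Variables (R : localRingType) (M : lmodType R) (iota : {linear M -> R^o}).
(** The image of [iota] is an ideal containing all nonunits, hence [m] or [R]; both cases are
    treated at once. *)
Hypothesis iotaI : injective iota.
Hypothesis iota_max : forall r : R, r \isn't a GRing.unit -> exists x, iota x = r.
Local Notation S := (idealization M).
Local Notation sc b := ((b, 0) : S).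

Lemma idz_mul (r s : R) (x y : M) :
  ((r, x) : S) * ((s, y) : S) = (r * s, r *: y + s *: x).
Proof. by []. Qed.

Lemma idz_add (r s : R) (x y : M) :
  ((r, x) : S) + ((s, y) : S) = (r + s, x + y).
Proof. by []. Qed.

Lemma idz_sub (r s : R) (x y : M) :
  ((r, x) : S) - ((s, y) : S) = (r - s, x - y).
Proof. by []. Qed.

Lemma idz_mull (r : R) (s : S) : ((r, 0) : S) * s = (r * s.1, r *: s.2).
Proof. by case: s => s y; rewrite idz_mul scaler0 addr0. Qed.

Lemma idz_lin (k r s : R) (x y : M) :
  sc k * (r, x) + (s, y) = (k * r + s, k *: x + y).
Proof. by rewrite idz_mull. Qed.

Lemma idz_mul0 (x : M) (s : S) : ((0, x) : S) * s = (0, s.1 *: x).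
Proof. by case: s => s y; rewrite idz_mul scale0r add0r mul0r. Qed.

Lemma idz_exp (a : R) n : ((a, 0) : S) ^+ n = (a ^+ n, 0).
Proof.
elim: n => [|n IH]; first by rewrite !expr0.
by rewrite !exprS IH idz_mull /= scaler0.
Qed.

Lemma iotaZ (k : R) x : iota (k *: x) = k * iota x.
Proof. exact: linZ. Qed.

Lemma idz_lreg (a : R) : GRing.lreg a -> GRing.lreg ((a, 0) : S).
Proof.
move=> ra; apply: mulrI0_lreg => -[r x]; rewrite idz_mull => -[].
move=> /(lreg_eq0 ra) /= -> ax; congr (_, _); apply: iotaI; rewrite lin0.
by apply: (lreg_eq0 ra); rewrite -iotaZ ax lin0.
Qed.

(** Over [R], the ring [S] is an extension of [R] by [M], a copy of an ideal; generators over [R]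
    also generate over [S]. *)
Lemma idz_noetherian : noetherian R -> noetherian S.
Proof.
move=> HR I HI.
have HM : noeth_mod M.
  move=> U HU; have HV : @is_submod R R^o (iota @` U).
    split; first by exists 0; [case: HU | rewrite lin0].
    move=> a _ _ [x Ux <-] [y Uy <-]; exists (a *: x + y); last exact: linP.
    exact: HU.2.
  have [n [g Hg]] := noeth_ring HR HV.
  have /choice[h hP] i : exists x, U x /\ iota x = g i.
    suff [x Ux <-] : (iota @` U) (g i) by exists x.
    apply/Hg; exists (fun l => (l == i)%:R).
    rewrite (bigD1 i) //= eqxx scale1r big1 ?addr0 // => l /negbTE ->.
    by rewrite scale0r.
  exists n, h => x; split.
    move=> Ux; have /Hg[c xE] : (iota @` U) (iota x) by exists x.
    exists c; apply: iotaI; rewrite xE linear_comb.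
    by apply: eq_bigr => i _; rewrite (hP i).2.
  move=> [c ->]; apply: submod_sum => // i _; apply: submodZ => //.
  by case: (hP i).
have lf : linear (fst : (R^o * M)%type -> R^o) by [].
have lg : linear (fun x : M => (0, x) : (R^o * M)%type).
  by move=> k x y; congr (_, _); rewrite /= scaler0 addr0.
have HV : noeth_mod (R^o * M)%type.
  apply: (@noeth_mod_ext _ _ _ _ (mklin lf) (mklin lg) _ (noeth_ring HR) HM).
  by case=> r x /= ->; exists x.
have HI' : @is_submod R (R^o * M)%type I.
  split; first by case: HI.
  move=> k [r x] [s y] Ix Iy; have := HI.2 (k, 0) _ _ Ix Iy.
  by rewrite idz_mull.
have [n [g Hg]] := HV _ HI'.
exists n, g; apply/seteqP; split=> [x /Hg[c ->]|_ [c ->]].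
  exists (fun i => (c i, 0)); apply: eq_bigr => i _.
  by rewrite idz_mull.
apply: (@submod_sum S S^o I HI) => i _; apply: (@submodZ S S^o I HI).
apply/Hg; exists (fun l => (l == i)%:R).
rewrite (bigD1 i) //= eqxx scale1r big1 ?addr0 // => l /negbTE ->.
by rewrite scale0r.
Qed.

(** Every prime contains [0 x M], whose elements have square zero; so the primes of [S] are those of
    [R]. *)
Lemma idz_prime_snd (P : set S) (r : R) (x y : M) :
  is_prime_ideal P -> P (r, x) -> P (r, y).
Proof.
move=> [IP _ PP] Pr.
have P0 : P (0, y - x).
  have : P (((0, y - x) : S) * ((0, y - x) : S)).
    by rewrite idz_mul0 scale0r; case: IP.
  by case/PP.
have := idealD IP Pr P0.
by rewrite idz_add addr0 addrC subrK.
Qed.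

Lemma idz_krull_dim : has_krull_dim R 1 -> has_krull_dim S 1.
Proof.
move=> [[P [Pp Pi]] nP]; split.
  exists (fun n => [set s : S | P n s.1]); split=> i i1.
    have [IP P1 PP] := Pp i i1; split=> //.
    - split; first by case: IP.
      by move=> [k m] [r x] [s y] Pr Ps; apply: IP.2.
    - by move=> [r x] [s y] /PP.
  have [sub nsub] := Pi i i1; split=> [[r x] /sub //|H].
  by apply: nsub => r Pr; apply: (H (r, 0)).
move=> [Q [Qp Qi]]; apply: nP.
exists (fun n => [set r : R | Q n (r, 0)]); split=> i i2.
  have [IQ Q1 QP] := Qp i i2; split=> //.
  - split; first by case: IQ.
    move=> k r s Qr Qs; have := IQ.2 (k, 0) _ _ Qr Qs.
    by rewrite idz_mull /= scaler0 idz_add addr0.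
  - move=> r s Qrs; apply: QP; rewrite idz_mull /= scaler0; exact: Qrs.
have [sub nsub] := Qi i i2; split=> [r /sub //|H].
apply: nsub => -[r x] Qr; apply: (idz_prime_snd (x := 0)).
  by apply: Qp; apply: ltnW.
by apply: H; apply: (idz_prime_snd (x := x)) => //; apply: Qp.
Qed.

(** * Canonical ideals: from the ring to its idealization *)

Section Ascent.
Variable J : set R.
Hypotheses (HJ : is_ideal J) (JN : forall j, J j -> exists x, iota x = j).

(* With [N] the image of [iota], this is [(J : N) x J = Hom_R(R |x M, J)]. *)
Definition idz_ideal : set S :=
  [set s | (forall x : M, J (s.1 * iota x)) /\ J (iota s.2)].

Lemma idz_idealP : is_ideal idz_ideal.
Proof.
split; first by split=> [x|] /=; rewrite ?mul0r ?lin0; apply: ideal0.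
move=> [k m] [r x] [s y] [Jr Jx] [Js Jy]; split=> /= [z|].
  by rewrite mulrDl -mulrA; apply: HJ.2.
rewrite !linD !iotaZ; apply: idealD => //; apply: idealD => //.
exact: ideal_mull.
Qed.

Lemma dilate_idz_ideal (b : R) (s : S) : GRing.lreg b ->
  dilate (sc b) idz_ideal s <->
  (exists2 c, s.1 = b * c & forall x, J (c * iota x)) /\ dilate b J (iota s.2).
Proof.
move=> rb; split=> [[[c y] [Jc Jy] ->]|[[c sc Jc] [j Jj sj]]].
  rewrite idz_mull /=; split; first by exists c.
  by exists (iota y) => //; rewrite iotaZ.
have [y yj] := JN Jj; exists (c, y); first by split=> //=; rewrite yj.
rewrite idz_mull /= [LHS]surjective_pairing sc; congr (_, _).
by apply: iotaI; rewrite iotaZ yj.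
Qed.

(** The fractions [c / b] that multiply the image of [iota] into [J] lie in [R]. *)
Hypothesis star : forall b c : R, GRing.lreg b -> b \isn't a GRing.unit ->
  (forall x : M, dilate b J (c * iota x)) -> exists c', c = b * c'.

Lemma idz_star (b c : R) : GRing.lreg b -> b \isn't a GRing.unit ->
  (forall x : M, dilate b J (c * iota x)) ->
  exists2 c', c = b * c' & forall x, J (c' * iota x).
Proof.
move=> rb ub bc; have [c' cE] := star rb ub bc; exists c' => // x.
by have [j Jj] := bc x; rewrite cE -mulrA => /rb ->.
Qed.

(** The second coordinate of the value determines the map. On [0 x M] it is multiplication by some
    [q]; what remains depends on [u] alone and is multiplication by [y0]. *)
Lemma idz_ext (b : R) : GRing.lreg b -> b \isn't a GRing.unit ->
  ext_ideal J b -> ext_ideal J (b * b) -> ext_ideal idz_ideal (sc b).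
Proof.
move=> rb ub extb extbb; apply: ext_ideal_intro => G [G0 GD] GJ Gb Gb0.
(* One works modulo [b ^ 2]: if [iota x = b ^ 2 r], then [x] is in [b M], as the nonunit [b r] comes
   from [M]. From [iota x = b r] this would not follow. *)
pose G1 u w := exists x v, [/\ G (0, x) v, u = iota x & w = b * iota v.2].
have GM (k s t v w : S) : G s v -> G t w -> G (k * s + t) (k * v + w).
  exact: GD.
have [||r w [x [v [Gx rx ->]]]|y1 Jy1 y1P] := extbb G1.
- split; first by exists 0, 0; rewrite /= lin0 mulr0.
  move=> k _ _ _ _ [x [v [Gx -> ->]]] [y [w [Gy -> ->]]].
  exists (k *: x + y), (sc k * v + w); rewrite linP; split=> //.
    by have := GM (sc k) _ _ _ _ Gx Gy; rewrite idz_lin mulr0 addr0.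
  by rewrite idz_mull /= (linP iota) /GRing.scale /=; ring.
- by move=> x w [y [v [/GJ[_ Jv] _ ->]]]; apply: ideal_mull.
- have [y yE] := iota_max (nonunitMl r ub).
  have xE : x = b *: y.
    by apply: iotaI; rewrite iotaZ yE -rx; ring.
  have := Gb (0, y) v; rewrite idz_mull /= mulr0 -xE => /(_ Gx).
  by move=> /(dilate_idz_ideal _ rb)[_ [j Jj ->]]; exists j => //; rewrite mulrA.
have [q y1E Jq] : exists2 q, y1 = b * q & forall x, J (q * iota x).
  apply: idz_star => // x.
  have [|j Jj] := y1P (iota (b *: x)) 0.
    exists (b *: x), 0; split=> //; last by rewrite /= lin0 mulr0.
    by have := Gb0 (0, x); rewrite idz_mull /= mulr0.
  rewrite sub0r iotaZ => e; exists (- j); first exact: idealN.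
  by apply: rb; rewrite !mulrN (mulrA b b j) -e; ring.
have Gq x v : G (0, x) v -> dilate b J (iota v.2 - iota x * q).
  move=> Gx; have [|j Jj e] := y1P (iota x) (b * iota v.2); first by exists x, v.
  exists j => //; apply: rb; rewrite mulrA -e y1E; ring.
have [||r w [x [v [Gx ->]]]|y0 Jy0 y0P] :=
  extb (fun u w => exists x v, G (u, x) v /\ w = iota v.2 - iota x * q).
- split; first by exists 0, 0; rewrite /= lin0 mul0r subr0.
  move=> k u u' _ _ [x [v [Gx ->]]] [y [w [Gy ->]]].
  exists (k *: x + y), (sc k * v + w); split.
    by have := GM (sc k) _ _ _ _ Gx Gy; rewrite idz_lin.
  by rewrite idz_mull /= !(linP iota) /GRing.scale /=; ring.
- move=> u w [x [v [/GJ[_ Jv] ->]]]; apply: idealB => //.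
  by rewrite mulrC.
- apply: Gq; have := GM (-1) _ _ _ _ (Gb0 (r, 0)) Gx.
  by rewrite mulr0 add0r mulN1r idz_mull scaler0 addrC idz_sub subrr subr0.
have [z zE] := JN Jy0.
exists (q, z); first by split; rewrite //= zE.
move=> [u x] v Gx; apply/dilate_idz_ideal => //; split; last first.
  have [|j Jj e] := y0P u (iota v.2 - iota x * q); first by exists x, v.
  exists j => //; rewrite -e idz_mul /= linB linD !iotaZ zE; ring.
(* The first coordinate is tested by multiplying by [(0, n)], which moves it to the second. *)
apply: idz_star => // n.
have := Gq (u *: n) (0, v.1 *: n); rewrite /= !iotaZ.
have -> : v.1 * iota n - u * iota n * q = (v.1 - u * q) * iota n by ring.
apply; have := GM (0, n) _ _ _ _ Gx G0.
by rewrite !addr0 !idz_mul0.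
Qed.

(** Being killed by [0 x M] modulo [b] makes the first coordinate of a socle element trivial, so the
    socle is that of [J/bJ] in the second coordinate. *)
Lemma idz_soc (b : R) : GRing.lreg b -> b \isn't a GRing.unit ->
  soc_ideal J b -> soc_ideal idz_ideal (sc b).
Proof.
move=> rb ub [t [Jt nt mt tP]]; have [z zt] := JN Jt.
have J0 x : J (0 * iota x) by rewrite mul0r; apply: ideal0.
exists (0, z); split.
- by split; rewrite //= zt.
- by move=> /(dilate_idz_ideal _ rb)[_ /=]; rewrite zt.
- move=> [r x] ur; rewrite mulrC idz_mul0 /=; apply/dilate_idz_ideal => //.
  split; first by exists 0; rewrite ?mulr0.
  by rewrite /= iotaZ zt; apply: mt.
move=> [c x] [Jc Jx] my; have [|c' cE Jc'] := @idz_star b c rb ub.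
  move=> y; have := my (0, y); rewrite idealization_unitE unitr0 => /(_ isT).
  by rewrite idz_mul0 => /(dilate_idz_ideal _ rb)[_]; rewrite /= iotaZ.
have [|s [j [Jj xE]]] := tP (iota x) Jx.
  move=> r ur; have := my (r, 0); rewrite idealization_unitE => /(_ ur).
  by rewrite idz_mull => /(dilate_idz_ideal _ rb)[_]; rewrite /= iotaZ.
have [w wj] := JN Jj; exists (s, 0), (c', w); split; first by split; rewrite //= wj.
rewrite !idz_mull /= mulr0 idz_add add0r cE; congr (_, _).
by apply: iotaI; rewrite linD !iotaZ zt wj.
Qed.

End Ascent.

(** * Canonical ideals: from the idealization to the ring *)

Section Descent.
Hypothesis (HR : noetherian R).
Variable J : set S.
Hypothesis (HJ : is_ideal J).

(* The annihilator of [0 x M] in [J], that is [Hom_S(R, J)]. *)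
Definition idz_core : set R := [set l | exists x, iota x = l /\ J (0, x)].
Definition idz_proj : set R := [set r | exists x, J (r, x)].

Lemma idz_coreP : is_ideal idz_core.
Proof.
split; first by exists 0; rewrite lin0; split=> //; case: HJ.
move=> k _ _ [x [<- Jx]] [y [<- Jy]]; exists (k *: x + y); split.
  exact: linP.
by have := HJ.2 (sc k) _ _ Jx Jy; rewrite idz_lin mulr0 addr0.
Qed.

Lemma idz_projP : is_ideal idz_proj.
Proof.
split; first by exists 0; case: HJ.
move=> k r s [x Jx] [y Jy]; exists (k *: x + y).
by have := HJ.2 (sc k) _ _ Jx Jy; rewrite idz_lin.
Qed.

Lemma mem_idz_core x : idz_core (iota x) <-> J (0, x).
Proof. by split=> [[y [/iotaI <-]]|Jx] //; exists x. Qed.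

Lemma dilate_core (b : R) (x : M) : GRing.lreg b ->
  dilate (sc b) J (0, x) <-> dilate b idz_core (iota x).
Proof.
move=> rb; split=> [[[r y] Jy]|[_ [y [<- Jy]] xE]].
  rewrite idz_mull /= => -[/esym /(lreg_eq0 rb) r0 ->]; rewrite r0 in Jy.
  by exists (iota y); [exists y | rewrite iotaZ].
exists (0, y) => //; rewrite idz_mull /= mulr0; congr (_, _).
by apply: iotaI; rewrite iotaZ.
Qed.

(* The projection of [J] is the full colon [idz_core : N] of the total ring of
   fractions: equality holds modulo [b], hence by Nakayama's lemma. *)
Lemma idz_core_colon (b c : R) : GRing.lreg b -> b \isn't a GRing.unit ->
  ext_ideal J (sc b) ->
  (forall x : M, dilate b idz_core (c * iota x)) -> dilate b idz_proj c.
Proof.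
move=> rb ub extJ.
pose D : set R := [set c | forall x : M, dilate b idz_core (c * iota x)].
have dP := dilateP b idz_coreP.
have step (e : R) : D e -> exists2 l, D l & dilate b idz_proj (e - b * l).
  move=> De.
  (* Multiplication by the fraction [e / b], as a map from [0 x M] to [J]. *)
  pose F (s v : S) := exists x y,
    [/\ s = (0, x), v = (0, y), J (0, y) & b * iota y = e * iota x].
  have [||s v [x [y [sE -> Jy bye]]]|[c0 d] Jc0 c0P] := extJ F.
  - split; first by exists 0, 0; rewrite !lin0 !mulr0; split=> //; case: HJ.
    move=> [k m] _ _ _ _ [x [y [-> -> Jy bye]]] [x' [y' [-> -> Jy' bye']]].
    exists (k *: x + x'), (k *: y + y'); split.
    + by rewrite /GRing.scale /= idz_mul scale0r addr0 idz_add mulr0 addr0.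
    + by rewrite /GRing.scale /= idz_mul scale0r addr0 idz_add mulr0 addr0.
    + by have := HJ.2 (sc k) _ _ Jy Jy'; rewrite idz_lin mulr0 addr0.
    + rewrite !(linP iota) /GRing.scale /=.
      transitivity (k * (b * iota y) + b * iota y'); first by ring.
      by rewrite bye bye'; ring.
  - by move=> s v [x [y [_ -> Jy _]]].
  - apply/dilate_core => //; move: sE; rewrite idz_mull => -[_ xE].
    have -> // : iota y = e * iota s.2.
    by apply: rb; rewrite bye -xE iotaZ; ring.
  have ebb x : exists2 l, idz_core l & (e - b * c0) * iota x = b * (b * l).
    have [l0 [y [yl0 Jy]] ex] := De x.
    have : F (0, x) (0, y) by exists x, y; split; rewrite ?yl0 ?ex.
    move=> /c0P; rewrite idz_mul0 idz_sub subrr => /(dilate_core _ rb)[l Ll].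
    rewrite linB iotaZ /= => lE; exists l => //.
    by rewrite -lE mulrBl ex -yl0; ring.
  have [n nb] := iota_max ub.
  (* At [iota n = b] one factor [b] cancels, so [b] divides [e - b c0] in [R]. *)
  have [l Ll lE] := ebb n.
  have eE : e - b * c0 = b * l by apply: rb; rewrite -lE nb mulrC.
  exists l => [x|]; last first.
    by exists c0; [exists d | rewrite -eE; ring].
  by have [l' Ll' l'E] := ebb x; exists l' => //; apply: rb; rewrite -l'E eE; ring.
move=> Dc.
have nxt (e : {e | D e}) : exists l : {e | D e},
    dilate b idz_proj (projT1 e - b * projT1 l).
  by case: e => e De; have [l Dl el] := step e De; exists (exist _ l Dl).
have [f fP] := choice nxt.
apply: (@krull_chain R R^o (dilate b idz_proj)
  (fun n => projT1 (iter n f (exist _ c Dc))) b).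
- exact: noeth_ring.
- exact: (ideal_submod (dilateP b idz_projP)).
- by move=> k; apply: unit_1B.
- by move=> n; apply: fP.
Qed.

(** A map on an ideal of [R] is lifted to [S] by ignoring second coordinates. The multiplier
    [(c, d)] found there kills [0 x M] modulo [b], so [c] is in [b] times the projection of [J], and
    [(c, d)] can be replaced by some [(0, z)]. *)
Lemma idz_core_ext (b : R) : GRing.lreg b -> b \isn't a GRing.unit ->
  ext_ideal J (sc b) -> ext_ideal idz_core b.
Proof.
move=> rb ub extJ G [G0 GD] GL Gb.
pose F (s v : S) := exists y, [/\ v = (0, y), J (0, y) & G s.1 (iota y)].
have [||[r x] v [y [-> Jy Gy]]|[c d] Jc cP] := extJ F.
- split; first by exists 0; rewrite lin0; split=> //; case: HJ.
  move=> [k m] [r x] [r' x'] _ _ [y [-> Jy Gy]] [y' [-> Jy' Gy']].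
  exists (k *: y + y'); split.
  + by rewrite /GRing.scale /= idz_mul scale0r addr0 idz_add mulr0 addr0.
  + by have := HJ.2 (sc k) _ _ Jy Jy'; rewrite idz_lin mulr0 addr0.
  + by rewrite linP; apply: GD.
- by move=> s v [y [-> Jy _]].
- by apply/dilate_core => //; move: Gy; rewrite idz_mull /=; apply: Gb.
have [c' [d' Jc'] cE] : dilate b idz_proj c.
  apply: idz_core_colon => // x.
  have : F (0, - x) (0, 0) by exists 0; rewrite lin0; split=> //; case: HJ.
  move=> /cP; rewrite idz_mul0 idz_sub subrr sub0r => /(dilate_core _ rb).
  by rewrite scalerN opprK iotaZ.
pose z := d - b *: d'.
have zE : ((c, d) : S) - sc b * (c', d') = (0, z) by rewrite idz_mull /= idz_sub cE subrr.
have Jz : J (0, z) by rewrite -zE; apply: idealB => //; apply: ideal_mull.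
exists (iota z); first by apply/mem_idz_core.
move=> r w Grw; have [y [yw Jy]] := GL _ _ Grw.
have : F (r, 0) (0, y) by exists y; rewrite yw.
move=> /cP [j Jj jE].
have -> : w - r * iota z = iota (y - r *: z).
  by rewrite -yw -iotaZ; exact: (esym (linB iota _ _)).
apply/dilate_core => //.
exists (j + sc r * (c', d')); first by apply: idealD => //; apply: ideal_mull.
rewrite mulrDr -jE.
have -> : ((c, d) : S) = (0, z) + sc b * (c', d') by rewrite -zE subrK.
transitivity (((0, y) : S) - sc r * (0, z)); last by ring.
by rewrite idz_mull /= idz_sub mulr0 subr0.
Qed.

(** As in [idz_core_ext], the socle generator is killed by [0 x M], so it can be taken of the form
    [(0, z)]. *)
Lemma idz_core_soc (b : R) : GRing.lreg b -> b \isn't a GRing.unit ->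
  ext_ideal J (sc b) -> soc_ideal J (sc b) -> soc_ideal idz_core b.
Proof.
move=> rb ub extJ [[t0 t1] [Jt nt mt tP]].
have [c' [d' Jc'] cE] : dilate b idz_proj t0.
  apply: idz_core_colon => // x; rewrite -iotaZ; apply/dilate_core => //.
  have := mt (0, x); rewrite idealization_unitE unitr0 => /(_ isT).
  by rewrite idz_mul0.
pose z := t1 - b *: d'.
have tE : ((t0, t1) : S) = (0, z) + sc b * (c', d').
  by rewrite idz_mull /= idz_add cE add0r subrK.
have Jz : J (0, z).
  have -> : (0, z) = ((t0, t1) : S) - sc b * (c', d') by rewrite tE addrK.
  by apply: idealB => //; apply: ideal_mull.
have Hb := dilateP (sc b) HJ.
have bJ : dilate (sc b) J (sc b * (c', d')) by exists (c', d').
exists (iota z); split.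
- exact/mem_idz_core.
- move=> /(dilate_core _ rb) bz; apply: nt; rewrite tE.
  exact: (idealD Hb bz bJ).
- move=> x ux; rewrite -iotaZ; apply/dilate_core => //.
  have := mt (sc x); rewrite idealization_unitE => /(_ ux) xt.
  have -> : (0, x *: z) = sc x * (t0, t1) - sc x * (sc b * (c', d')).
    by rewrite -mulrBr tE addrK idz_mull mulr0.
  by apply: idealB => //; apply: ideal_mull.
move=> _ [y [<- Jy]] my.
have [|[s0 s1] [[j0 j1] [Jj]]] := tP (0, y) Jy.
  move=> [r x]; rewrite idealization_unitE /= => ur.
  rewrite mulrC idz_mul0 /=; apply/dilate_core => //; rewrite iotaZ.
  exact: my.
move=> yE; pose w := ((s0, s1) : S) * ((c', d') : S) + ((j0, j1) : S).
have wE : sc b * w = (0, y - s0 *: z).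
  have -> : (0, y - s0 *: z) = ((0, y) : S) - ((0, z) : S) * ((s0, s1) : S).
    by rewrite idz_mul0 idz_sub subrr.
  by rewrite yE tE /w; ring.
have : dilate (sc b) J (0, y - s0 *: z).
  exists w => //; apply: idealD => //; exact: ideal_mull.
move=> /(dilate_core _ rb)[l Ll lE]; exists s0, l; split=> //.
rewrite -lE -iotaZ -[LHS]/(iota y); apply: etrans (linD iota _ _).
by rewrite addrC subrK.
Qed.


End Descent.
End Idealization.

(** * Reductions *)

Section IdealProducts.
Variable R : comUnitRingType.
Implicit Types I J K : set R.

Lemma ideal_mulP I J : is_ideal I -> is_ideal (ideal_mul I J).
Proof.
move=> HI; split.
  by exists 0%N, (fun=> 0), (fun=> 0); split; [case | rewrite big_ord0].
move=> k _ _ [n [a [b [ab ->]]]] [m [c [d [cd ->]]]].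
exists (n + m)%N, (fun i => match split i with inl j => k * a j | inr j => c j end),
  (fun i => match split i with inl j => b j | inr j => d j end); split.
  move=> i; case: (split i) => j; last exact: cd.
  by split; [apply: ideal_mull => //; apply: (ab j).1 | apply: (ab j).2].
rewrite big_split_ord /= mulr_sumr; congr (_ + _); apply: eq_bigr => i _.
  by rewrite (unsplitK (inl _ i)) mulrA.
by rewrite (unsplitK (inr _ i)).
Qed.

Lemma mem_ideal_mul I J x y : I x -> J y -> ideal_mul I J (x * y).
Proof.
by move=> Ix Jy; exists 1%N, (fun=> x), (fun=> y); split=> //; rewrite big_ord1.
Qed.

Lemma ideal_mul_sub I J K : is_ideal K ->
  (forall x y, I x -> J y -> K (x * y)) -> ideal_mul I J `<=` K.
Proof.
move=> HK H _ [n [a [b [ab ->]]]]; apply: (@submod_sum R R^o K HK) => i _.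
by apply: H; case: (ab i).
Qed.

Lemma ideal_colon K s : is_ideal K -> is_ideal [set t | K (s * t)].
Proof.
move=> HK; split=> [|k x y Kx Ky] /=; first by rewrite mulr0; exact: ideal0.
by rewrite mulrDr mulrCA; apply: HK.2.
Qed.

Lemma ideal_expP I n : is_ideal I -> is_ideal (ideal_exp I n).
Proof. by move=> HI; case: n => [|n] //; exact: ideal_mulP. Qed.

Lemma mem_ideal_exp I x n : I x -> ideal_exp I n (x ^+ n).
Proof.
by move=> Ix; elim: n => [|n IH] //; rewrite exprS; apply: mem_ideal_mul.
Qed.

Lemma reduction_sub I J n : is_ideal I -> is_ideal J -> J `<=` I ->
  ideal_exp I n.+1 `<=` ideal_mul J (ideal_exp I n) -> is_reduction J I.
Proof.
move=> HI HJ JI H; split=> //; exists n; apply/seteqP; split=> //.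
apply: ideal_mul_sub => [|x y Jx]; first exact: ideal_expP.
by apply: mem_ideal_mul; apply: JI.
Qed.

Lemma reduction_succ I J n : is_ideal J ->
  ideal_exp I n.+1 `<=` ideal_mul J (ideal_exp I n) ->
  ideal_exp I n.+2 `<=` ideal_mul J (ideal_exp I n.+1).
Proof.
move=> HJ H; have HK := @ideal_mulP J (ideal_exp I n.+1) HJ.
apply: ideal_mul_sub => // x y Ix /H; apply: (ideal_mul_sub (ideal_colon x HK)).
move=> j z Jj Iz; rewrite /= mulrCA; apply: mem_ideal_mul => //.
exact: mem_ideal_mul.
Qed.

Lemma reduction_mem I J x : is_ideal J -> is_reduction J I -> I x ->
  exists n, J (x ^+ n.+1).
Proof.
move=> HJ [_ [n e]] Ix; exists n.
have : ideal_exp I n.+1 (x ^+ n.+1) by exact: mem_ideal_exp.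
rewrite e; apply: ideal_mul_sub => // y z Jy _; exact: ideal_mulr.
Qed.

End IdealProducts.

(** * Canonical ideals up to a regular factor *)

Section Scaling.
Variable R : localRingType.

Lemma canonical_dilate (J : set R) a :
  GRing.lreg a -> canonical_ideal J -> canonical_ideal (dilate a J).
Proof.
move=> ra [HJ [C [f [HC fI JE]]]]; split; first exact: dilateP.
have lf : linear (fun c => a *: f c : R^o).
  by move=> k x y; rewrite linP scalerDr !scalerA mulrC.
exists C, (mklin lf); split=> // [x y /ra /fI //|].
apply/seteqP; split=> [_ [j + ->]|_ [c _ <-]]; rewrite JE.
  by move=> [c _ <-]; exists c.
by exists (f c) => //; exists c.
Qed.

Lemma canonical_undilate (J : set R) a : GRing.lreg a -> is_ideal J ->
  canonical_ideal (dilate a J) -> canonical_ideal J.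
Proof.
move=> ra HJ [_ [C [f [HC fI JE]]]]; split=> //.
have /choice[g gP] c : exists j : R^o, J j /\ f c = a * j.
  have [j Jj e] : dilate a J (f c) by rewrite JE; exists c.
  by exists j.
have lg : linear g.
  move=> k x y; apply: ra; rewrite -(gP _).2 linP !(gP _).2.
  by rewrite /GRing.scale /=; ring.
exists C, (mklin lg); split=> // [x y gxy|].
  by apply: fI; rewrite !(gP _).2; congr (_ * _).
apply/seteqP; split=> [j Jj|_ [c _ <-]]; last by case: (gP c).
have : dilate a J (a * j) by exists j.
by rewrite JE => -[c _ fc]; exists c => //; apply: ra; rewrite -fc (gP c).2.
Qed.

End Scaling.

(** * Colon ideals in dimension one *)

Section LocalRing.
Variable R : localRingType.
Hypotheses (HR : noetherian R) (Hdim : has_krull_dim R 1).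
Let m := [set x : R | x \in @maxideal R].
Let Hm : is_ideal m. Proof. exact: max_closed. Qed.

Lemma CM_regular : cohen_macaulay R ->
  exists a : R, GRing.lreg a /\ a \isn't a GRing.unit.
Proof.
move=> [_ [d [dimd [[rs [srs [rm rr _]]] _]]]].
rewrite (krull_dim_inj dimd Hdim) in srs.
case: rs srs rm rr => [|r [|? ?]] //= _ rm rr; exists r; split; last exact: (rm 0%N).
apply: mulrI0_lreg => x rx0.
by apply/(seq_submod_nil (M := R^o)); apply: (rr 0%N) => //; apply/seq_submod_nil.
Qed.

(* [J : J = R]. *)
Lemma ext_soc_faithful (J : set R) b z : is_ideal J ->
  ext_ideal J b -> soc_ideal J b ->
  (forall j, J j -> dilate b J (z * j)) -> exists z', z = b * z'.
Proof.
move=> HJ extb [t [Jt nt mt _]] zJ; apply: contrapT => nz.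
(* If [b] does not divide [z], then [k z -> k t] is well defined modulo [b], since [b | k z] forces
   [k] to be a nonunit. Its extension gives [t = z y] modulo [bJ], where [z y] vanishes. *)
have [||r v [k [rzk ->]]|y Jy yP] := extb (fun x v => exists k, x = k * z /\ v = k * t).
- split; first by exists 0; split; ring.
  move=> c _ _ _ _ [k [-> ->]] [l [-> ->]]; exists (c * k + l).
  by split; rewrite /GRing.scale /=; ring.
- by move=> _ _ [k [_ ->]]; apply: ideal_mull.
- apply: mt; apply/negP => uk; apply: nz; exists (k^-1 * r).
  by rewrite mulrCA rzk mulKr.
have := yP z t; case=> [|j Jj e]; first by exists 1; split; ring.
apply: nt; have [j' Jj' e'] := zJ y Jy; exists (j + j'); first exact: idealD.
by rewrite mulrDr -e -e'; ring.
Qed.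

(* The colon [J : m], taken in the total ring of fractions, lies in [R]: modulo
   [J] it is the one-dimensional socle, already found in [R/J]. *)
Lemma max_colon (J : set R) b0 b c : is_ideal J -> J `<=` m -> J b0 ->
  GRing.lreg b0 -> GRing.lreg b -> b \isn't a GRing.unit ->
  soc_ideal J (b * b0) ->
  (forall x, x \isn't a GRing.unit -> dilate b J (c * x)) ->
  exists c', c = b * c'.
Proof.
move=> HJ Jm Jb0 rb0 rb ub [t [Jt nt mt tP]] cm.
have J1 : ~ J 1 by move=> /Jm; rewrite /m /= /in_mem /= /maxideal unitr1.
have [|u [nu mu]] := exists_socle_ideal HR Hdim.2 HJ J1 rb0.
  by rewrite mulr1.
rewrite mulr1 in nu mu.
have rbb : GRing.lreg (b * b0) by apply: lregM.
(* Both [u b b0] and [c b0] lie in the socle of [J / b b0 J]. The first is nonzero there, hence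
   spans it; so the second is a multiple of it. *)
have [||s [j [Jj e]]] := tP (u * b * b0).
- by apply: ideal_mull.
- move=> x /mu xu; exists (x * u) => //; ring.
have us : s \is a GRing.unit.
  apply: contraT => /mt[j' Jj' st]; exfalso; apply: nu.
  have -> : u = j' + j; last exact: idealD.
  by apply: rbb; rewrite mulrDr -st -e; ring.
have [||s' [j' [Jj' e']]] := tP (c * b0).
- exact: ideal_mull.
- move=> x /cm[k Jk ck]; exists k => //.
  by transitivity ((c * x) * b0); [ring | rewrite ck; ring].
exists (s' * s^-1 * (u - j) + j'); apply: rb0.
have tE : t = s^-1 * (u * b * b0 - b * b0 * j) by rewrite e addrK mulKr.
by rewrite mulrC e' tE; ring.
Qed.

(* If [m : m = R], then [R] is a discrete valuation ring. *)
Lemma principal_max (a : R) : GRing.lreg a -> a \isn't a GRing.unit ->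
  (forall b c : R, GRing.lreg b -> b \isn't a GRing.unit ->
     (forall x : R, x \isn't a GRing.unit ->
        exists2 y : R, y \isn't a GRing.unit & c * x = b * y) ->
     exists c', c = b * c') ->
  exists x : R, [/\ GRing.lreg x, x \isn't a GRing.unit &
    forall y : R, y \isn't a GRing.unit -> exists r, y = x * r].
Proof.
move=> ra ua Hc.
have HaR : is_ideal (dilate a setT) by apply: dilateP.
have [||u [nu mu]] := exists_socle_ideal HR Hdim.2 (v := 1) HaR _ ra.
- by case=> r _ /esym e; move/negP: ua; apply; apply/unitrPr; exists r.
- by exists 1.
rewrite mulr1 in nu mu.
(* The fraction [u / a] multiplies [m] into [R] and is not in [R]. As [m : m = R], it takes some [x]
   in [m] to a unit, and this [x] generates [m]. *)
have [x [ux [e [ue xu]]]] : exists x : R, x \isn't a GRing.unit /\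
    exists e : R, e \is a GRing.unit /\ u * x = a * e.
  apply: contrapT => nex; apply: nu.
  have [|c' ->] := Hc a u ra ua; last by exists c'.
  move=> x ux; have [r _ xr] := mu x ux; exists r; last by rewrite mulrC xr.
  apply/negP => ur; apply: nex; exists x; split=> //; exists r; split=> //.
  by rewrite mulrC xr.
have rux : GRing.lreg (u * x).
  by rewrite xu; apply: lregM => // y z; apply: (mulrI ue).
exists x; split=> //; first exact: GRing.lregMl rux.
move=> y uy; have [r _ yr] := mu y uy; exists (e^-1 * r).
have ru : GRing.lreg u by apply: (@GRing.lregMl _ x); rewrite mulrC.
apply: ru; rewrite [LHS]mulrC yr.
have -> : u * (x * (e^-1 * r)) = u * x * e^-1 * r by rewrite !mulrA.
by rewrite xu mulrK.
Qed.

End LocalRing.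

(** * Powers and reductions of the maximal ideal of an idealization *)

Section IdealizationReduction.
Variables (R : localRingType) (M : lmodType R).
Local Notation S := (idealization M).
Local Notation sc b := ((b, 0) : S).
Let m := [set x : R | x \in @maxideal R].
Let mS := [set x : S | x \in @maxideal S].
Let Hm : is_ideal m. Proof. exact: max_closed. Qed.
Let HmS : is_ideal mS. Proof. exact: (@max_closed S). Qed.

(* [mS ^ (k + 1) = m ^ (k + 1) x m ^ k M], since [0 x M] has square zero. *)
Lemma idz_exp_sub k (K : set S) : is_ideal K ->
  (forall r, ideal_exp m k.+1 r -> K (r, 0)) ->
  (forall r y, ideal_exp m k r -> K (0, r *: y)) ->
  ideal_exp mS k.+1 `<=` K.
Proof.
have split_pair (r : R) (x : M) : ((r, x) : S) = sc r + (0, x).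
  by rewrite idz_add addr0 add0r.
elim: k K => [|k IH] K HK K1 K2.
  apply: ideal_mul_sub => // -[r x] t mr _; apply: ideal_mulr => //.
  rewrite split_pair; apply: (idealD HK); last by rewrite -[x]scale1r; apply: K2.
  by apply: K1; rewrite -[r]mulr1; apply: mem_ideal_mul.
apply: ideal_mul_sub => // -[a x] t ma.
suff : ideal_exp mS k.+1 `<=` [set t | K (((a, x) : S) * t)] by apply.
apply: IH.
- exact: ideal_colon.
- move=> r mr; rewrite /= mulrC idz_mull /= split_pair.
  apply: (idealD HK); last exact: K2.
  by apply: K1; rewrite mulrC; apply: mem_ideal_mul.
- move=> r y mr; rewrite /= mulrC idz_mul0 /= scalerA; apply: K2.
  exact: mem_ideal_mul.
Qed.

Lemma idz_exp_scalar k r : ideal_exp m k r -> ideal_exp mS k (sc r).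
Proof.
elim: k r => [//|k IH] r.
apply: (ideal_mul_sub (K := [set r | ideal_exp mS k.+1 (sc r)])).
  have HK := @ideal_expP _ mS k.+1 HmS.
  split=> [|a x y Kx Ky] /=; first exact: (ideal0 HK).
  by have := HK.2 (sc a) _ _ Kx Ky; rewrite idz_lin scaler0 addr0.
move=> x y mx my /=; have -> : sc (x * y) = sc x * sc y by rewrite idz_mull scaler0.
by apply: mem_ideal_mul => //; apply: IH.
Qed.

Lemma idz_exp_fst k (s : S) : ideal_exp mS k s -> ideal_exp m k s.1.
Proof.
elim: k s => [//|k IH] s.
apply: (ideal_mul_sub (K := [set s : S | ideal_exp m k.+1 s.1])).
  have HK := @ideal_expP _ m k.+1 Hm.
  by split=> [|a x y Kx Ky] /=; [exact: (ideal0 HK) | apply: HK.2].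
move=> [x x'] [y y'] mx my /=; apply: mem_ideal_mul => //.
exact: (IH _ my).
Qed.

Lemma idz_reduction_lift (J : set R) (J' : set S) : is_ideal J -> is_ideal J' ->
  J' `<=` mS -> is_reduction J m -> (forall j, J j -> J' (j, 0)) ->
  is_reduction J' mS.
Proof.
move=> HJ HJ' J'm [Jm [n e]] JJ'.
have en : ideal_exp m n.+1 `<=` ideal_mul J (ideal_exp m n) by rewrite -e.
(* One power more than in [R]: the second component of [mS ^ (n + 2)] is only [m ^ (n + 1) M]. *)
apply: (@reduction_sub _ _ _ n.+1) => //.
have HK := @ideal_mulP _ J' (ideal_exp mS n.+1) HJ'.
apply: idz_exp_sub => // [r|r y].
  move/(reduction_succ HJ en).
  apply: (ideal_mul_sub (K := [set r | ideal_mul J' (ideal_exp mS n.+1) (sc r)])).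
    split=> [|a x z Kx Kz] /=; first exact: (ideal0 HK).
    by have := HK.2 (sc a) _ _ Kx Kz; rewrite idz_lin scaler0 addr0.
  move=> j z Jj mz /=; have -> : sc (j * z) = sc j * sc z by rewrite idz_mull scaler0.
  by apply: mem_ideal_mul; [exact: JJ' | exact: (idz_exp_scalar mz)].
move/en.
apply: (ideal_mul_sub (K := [set r | ideal_mul J' (ideal_exp mS n.+1) (0, r *: y)])).
  split=> [|a x z Kx Kz] /=; first by rewrite scale0r; exact: (ideal0 HK).
  have := HK.2 (sc a) _ _ Kx Kz; rewrite idz_lin mulr0 addr0.
  by rewrite scalerA -scalerDl.
move=> j z Jj mz /=.
have -> : (0, (j * z) *: y) = sc j * (((0, y) : S) * sc z).
  by rewrite idz_mul0 idz_mull /= mulr0 scalerA.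
apply: mem_ideal_mul; first exact: JJ'.
apply: mem_ideal_mul; last exact: (idz_exp_scalar mz).
by rewrite /mS /= /in_mem /= /maxideal idealization_unitE unitr0.
Qed.

Lemma idz_reduction_proj (J' : set S) : is_reduction J' mS ->
  is_ideal J' ->
  idz_proj J' `<=` m /\ exists n,
    ideal_exp m n.+1 `<=` ideal_mul (idz_proj J') (ideal_exp m n).
Proof.
move=> [J'm [n e]] HJ'; split=> [r [x /J'm //]|]; exists n => r.
move=> /idz_exp_scalar; rewrite e.
have HK := @ideal_mulP _ (idz_proj J') (ideal_exp m n) (idz_projP HJ').
apply: (ideal_mul_sub (K := [set s : S | ideal_mul (idz_proj J') (ideal_exp m n) s.1])).
  by split=> [|a x y Kx Ky] /=; [exact: (ideal0 HK) | apply: HK.2].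
move=> [x x'] t Jx mt; apply: mem_ideal_mul; first by exists x'.
exact: idz_exp_fst.
Qed.

End IdealizationReduction.

(** * Transfer of canonical ideals *)

Section Transfer.
Variable R : localRingType.
Hypotheses (HR : noetherian R) (Hdim : has_krull_dim R 1).
Variables (M : lmodType R) (iota : {linear M -> R^o}).
Hypothesis iotaI : injective iota.
Hypothesis iota_max : forall r : R, r \isn't a GRing.unit -> exists x, iota x = r.
Local Notation S := (idealization M).
Local Notation sc b := ((b, 0) : S).
Let m := [set x : R | x \in @maxideal R].
Let mS := [set x : S | x \in @maxideal S].
Let Hm : is_ideal m. Proof. exact: max_closed. Qed.

Lemma idz_ideal_canonical (J : set R) a : canonical_ideal J -> J a ->
  GRing.lreg a -> a \isn't a GRing.unit ->
  (forall j, J j -> exists x, iota x = j) ->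
  (forall b c : R, GRing.lreg b -> b \isn't a GRing.unit ->
    (forall x : M, dilate b J (c * iota x)) -> exists c', c = b * c') ->
  canonical_ideal (idz_ideal iota J).
Proof.
move=> cJ Ja ra ua JN star; have HJ : is_ideal J by case: cJ.
have props b := canonical_ideal_props HR Hdim (a := b) cJ.
apply: (@ideal_canonical _ (idz_noetherian iotaI HR) (idz_krull_dim _ Hdim) _
  (idz_idealP iota HJ) (sc a)).
- by split=> [x|] /=; [apply: ideal_mulr | rewrite lin0; apply: ideal0].
- exact: (idz_lreg iotaI ra).
- by rewrite idealization_unitE.
- case=> // n _; rewrite idz_exp.
  have rn : GRing.lreg (a ^+ n.+1) by apply: lregX.
  have un : a ^+ n.+1 \isn't a GRing.unit by rewrite exprSr; apply: nonunitMl.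
  apply: idz_ext => //; first by case: (props _ rn un).
  by case: (props (a ^+ n.+1 * a ^+ n.+1)) => //; [apply: lregM | apply: nonunitMl].
- by apply: idz_soc => //; case: (props _ ra ua).
Qed.

Lemma idz_core_props (J : set S) (b : R) : canonical_ideal J ->
  GRing.lreg b -> b \isn't a GRing.unit ->
  [/\ ext_ideal J (sc b), ext_ideal (idz_core iota J) b &
      soc_ideal (idz_core iota J) b].
Proof.
move=> cJ rb ub; have HJ : is_ideal J by case: cJ.
have [extJ socJ] := canonical_ideal_props (idz_noetherian iotaI HR)
  (idz_krull_dim M Hdim) cJ (idz_lreg iotaI rb) (ub : sc b \isn't a GRing.unit).
split=> //; first exact: idz_core_ext.
exact: idz_core_soc.
Qed.

Lemma idz_core_canonical (J : set S) a : canonical_ideal J -> idz_core iota J a ->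
  GRing.lreg a -> a \isn't a GRing.unit -> canonical_ideal (idz_core iota J).
Proof.
move=> cJ La ra ua; have HJ : is_ideal J by case: cJ.
apply: (@ideal_canonical _ HR Hdim _ (idz_coreP iota HJ) a) => //.
- case=> // n _.
  have rn : GRing.lreg (a ^+ n.+1) by apply: lregX.
  have un : a ^+ n.+1 \isn't a GRing.unit by rewrite exprSr; apply: nonunitMl.
  by case: (idz_core_props cJ rn un).
- by case: (idz_core_props cJ ra ua).
Qed.

End Transfer.

(** * Ascent and descent of canonical reductions *)

Section MainLemmas.
Variable R : localRingType.
Hypotheses (HR : noetherian R) (Hdim : has_krull_dim R 1).
Variable (a : R).
Hypotheses (ra : GRing.lreg a) (ua : a \isn't a GRing.unit).
Let m := [set x : R | x \in @maxideal R].
Let Hm : is_ideal m. Proof. exact: max_closed. Qed.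
Let m_a : m a. Proof. exact: ua. Qed.

Lemma reduction_lreg (J : set R) : is_ideal J -> is_reduction J m ->
  exists b, [/\ J b, GRing.lreg b & b \isn't a GRing.unit].
Proof.
move=> HJ rJ; have [n Jn] := reduction_mem HJ rJ m_a.
exists (a ^+ n.+1); split=> //; first exact: lregX.
by rewrite exprSr; apply: nonunitMl.
Qed.

Lemma idz_reduction_scalar (M : lmodType R) (J : set (idealization M)) :
  is_ideal J -> is_reduction J [set x | x \in @maxideal (idealization M)] ->
  exists n, J (a ^+ n.+1, 0).
Proof.
move=> HJ /(@reduction_mem _ _ _ ((a, 0) : idealization M) HJ)[|n].
  exact: ua.
by rewrite idz_exp; exists n.
Qed.

Let idR : {linear R^o -> R^o} := mklin (fun k (x y : R^o) => erefl (k *: x + y)).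

(** For [M = R] the colon is [J] itself, so the ideal is [J x J]. *)
Lemma canonical_reduction_self :
  has_canonical_reduction R -> has_canonical_reduction (@idealization R R^o).
Proof.
move=> [J [cJ rJ]]; have HJ : is_ideal J by case: cJ.
have [b [Jb rb ub]] := reduction_lreg HJ rJ.
have idI : injective idR by [].
have idm (r : R) : r \isn't a GRing.unit -> exists x, idR x = r by exists r.
exists (idz_ideal idR J); split.
  apply: (idz_ideal_canonical HR Hdim idI idm cJ Jb rb ub) => [j _|c d _ _ /(_ 1)].
    by exists j.
  by rewrite mklinE mulr1 => -[c' _ ->]; exists c'.
apply: (idz_reduction_lift HJ _ _ rJ).
- exact: idz_idealP.
- by move=> [r x] [/(_ 1)]; rewrite mklinE mulr1 => /rJ.1 mr _; exact: mr.
- by move=> j Jj; split=> [x|] /=; [apply: ideal_mulr | apply: ideal0].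
Qed.

Lemma canonical_reduction_of_self :
  has_canonical_reduction (@idealization R R^o) -> has_canonical_reduction R.
Proof.
move=> [J [cJ rJ]]; have HJ : is_ideal J by case: cJ.
have idI : injective idR by [].
have idm (r : R) : r \isn't a GRing.unit -> exists x, idR x = r by exists r.
have [n Jan] := idz_reduction_scalar HJ rJ.
have PL : idz_proj J `<=` idz_core idR J.
  move=> r [x Jr]; exists r; split=> //.
  have := ideal_mull ((0, 1) : @idealization R R^o) HJ Jr; rewrite idz_mul0.
  by rewrite /GRing.scale /= mulr1.
have HL := idz_coreP idR HJ.
have LP : idz_core idR J `<=` idz_proj J.
  move=> l Ll; have [extJ _ _] := idz_core_props HR Hdim idI idm cJ ra ua.
  suff [p Pp /ra ->] : dilate a (idz_proj J) (a * l) by [].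
  apply: (idz_core_colon idI idm HR HJ ra ua extJ) => x.
  by exists (l * x); [apply: ideal_mulr | rewrite mulrA].
have [Pm [k e]] := idz_reduction_proj rJ HJ.
exists (idz_core idR J); split.
  apply: (idz_core_canonical HR Hdim idI idm cJ) (PL _ _) _ _.
  - by exists 0; exact: Jan.
  - exact: lregX.
  - by rewrite exprSr; apply: nonunitMl.
apply: (@reduction_sub _ _ _ k) => //; first by move=> l /LP/Pm.
move=> x /e; apply: ideal_mul_sub => [|y z /PL Ly]; first exact: ideal_mulP.
exact: mem_ideal_mul.
Qed.

Let valR : {linear maxmodule R -> R^o} :=
  mklin ((fun k x y => erefl) : linear (val : maxmodule R -> R^o)).

Let valI : injective valR. Proof. exact: val_inj. Qed.

Let val_m (r : R) : r \isn't a GRing.unit -> exists x, valR x = r.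
Proof. by move=> ur; exists (MaxModule (ur : r \in @maxsubmod R)). Qed.

Let m_val (x : maxmodule R) : (valR x : R) \isn't a GRing.unit.
Proof. by rewrite mklinE; exact: (valP x). Qed.

Lemma canonical_reduction_max :
  has_canonical_reduction R -> has_canonical_reduction (@idealization R (maxmodule R)).
Proof.
move=> [J [cJ rJ]]; have HJ : is_ideal J by case: cJ.
have [b0 [Jb0 rb0 ub0]] := reduction_lreg HJ rJ.
have Jm : J `<=` m by case: rJ.
have star (b c : R) : GRing.lreg b -> b \isn't a GRing.unit ->
    (forall x, x \isn't a GRing.unit -> dilate b J (c * x)) ->
    exists c', c = b * c'.
  move=> rb ub; apply: (max_colon HR Hdim HJ Jm Jb0 rb0 rb ub).
  have rbb : GRing.lreg (b * b0) by apply: lregM.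
  by case: (canonical_ideal_props HR Hdim cJ rbb (nonunitMl b ub0)).
have cJ' : canonical_ideal (idz_ideal valR J).
  apply: (idz_ideal_canonical HR Hdim valI val_m cJ Jb0 rb0 ub0) => [j /Jm|b c rb ub H].
    exact: val_m.
  by apply: star => // x /val_m[y <-].
have HJ' : is_ideal (idz_ideal valR J) by case: cJ'.
(* If [J] is not [m], then [(J : m) x J] is proper, since a unit in [J : m] would put [m] inside
   [J]. If [J = m], then [star] says that [m : m = R]. *)
have [[y [my nJy]]|Jmax] := pselect (exists y, m y /\ ~ J y).
  exists (idz_ideal valR J); split=> //.
  apply: (idz_reduction_lift HJ HJ' _ rJ).
    move=> [r x] [Jr _]; apply/negP => ur; apply: nJy.
    rewrite idealization_unitE /= in ur.
    rewrite -(mulKr ur y); apply: ideal_mull => //.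
    by have [z <-] := val_m my; apply: Jr.
  by move=> j Jj; split=> [x|] /=; [apply: ideal_mulr | apply: ideal0].
have mJ y : m y -> J y by move=> my; apply: contrapT => nJy; apply: Jmax; exists y.
have [x0 [rx0 ux0 x0P]] : exists x : R, [/\ GRing.lreg x, x \isn't a GRing.unit &
    forall y : R, y \isn't a GRing.unit -> exists r, y = x * r].
  apply: (principal_max HR Hdim ra ua) => b c rb ub H; apply: star => // x /H[y uy ->].
  by exists y => //; apply: mJ.
exists (dilate ((x0, 0) : idealization (maxmodule R)) (idz_ideal valR J)); split.
  by apply: canonical_dilate => //; exact: (idz_lreg valI rx0).
apply: (idz_reduction_lift HJ _ _ rJ).
- exact: dilateP.
- move=> _ [s _ ->]; rewrite mulrC.
  exact: (@nonunitMl (idealization (maxmodule R)) s (x0, 0)).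
- move=> j /Jm/x0P[r ->]; exists (r, 0); last by rewrite idz_mull scaler0.
  split=> [x|] /=; last exact: ideal0.
  by apply: mJ; apply: nonunitMl; apply: m_val.
Qed.

Lemma canonical_reduction_of_max :
  has_canonical_reduction (@idealization R (maxmodule R)) -> has_canonical_reduction R.
Proof.
move=> [J [cJ rJ]]; have HJ : is_ideal J by case: cJ.
have [n Jan] := idz_reduction_scalar HJ rJ.
pose L := idz_core valR J; pose P := idz_proj J.
have HL : is_ideal L := idz_coreP valR HJ.
have HP : is_ideal P := idz_projP HJ.
have props b := idz_core_props HR Hdim valI val_m (b := b) cJ.
have colon (b c : R) : GRing.lreg b -> b \isn't a GRing.unit ->
    (forall x, x \isn't a GRing.unit -> dilate b L (c * x)) -> dilate b P c.
  move=> rb ub bc; have [extJ _ _] := props b rb ub.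
  apply: (idz_core_colon valI val_m HR HJ rb ub extJ) => x.
  by apply: bc; apply: m_val.
have PmL r x : P r -> x \isn't a GRing.unit -> L (r * x).
  move=> [y Jr] /val_m[z <-]; exists (r *: z); split; first exact: linZ.
  by have := ideal_mull ((0, z) : idealization (maxmodule R)) HJ Jr; rewrite idz_mul0.
have LP : L `<=` P.
  move=> l Ll; suff [p Pp /ra ->] : dilate a P (a * l) by [].
  apply: colon => // x ux; exists (l * x); [exact: ideal_mulr | by rewrite mulrA].
have [Pm [k e]] := idz_reduction_proj rJ HJ.
have cL : canonical_ideal L.
  have Pa : P (a ^+ n.+1) by exists 0.
  apply: (idz_core_canonical HR Hdim valI val_m cJ) (PmL _ _ Pa ua) _ _.
    by rewrite -exprSr; apply: lregX.
  exact: nonunitMl.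
(* Either some fraction [c / b] lies in [m : m] but not in [R], or [m] is principal. *)
have [[b [c [rb ub bc nc]]]|allc] := pselect (exists b c : R,
    [/\ GRing.lreg b, b \isn't a GRing.unit,
      (forall x : R, x \isn't a GRing.unit ->
        exists2 y : R, y \isn't a GRing.unit & c * x = b * y) &
      ~ exists c', c = b * c']).
  exists L; split=> //.
  have [l [Ll ncl]] : exists l, L l /\ ~ dilate b L (c * l).
    apply: contrapT => nex; apply: nc.
    have [_ extL socL] := props b rb ub.
    apply: (ext_soc_faithful HL extL socL) => j Lj.
    by apply: contrapT => ncj; apply: nex; exists j.
  (* The element [c' = (c / b) l] multiplies [m] into [L], hence lies in [P], but it is outside
     [L]. *)
  have [|c' Pc' cl] := colon b (c * l) rb ub.
    move=> x /bc[y uy cx]; exists (l * y); first exact: ideal_mulr.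
    by rewrite mulrAC cx; ring.
  have nLc' : ~ L c' by move=> Lc'; apply: ncl; exists c'.
  have [_ _ [t [Lt nt mt tP]]] := props a ra ua.
  (* Multiplication by [a] embeds [P/L] into the socle of [L/aL], so [c'] spans [P/L]. *)
  have Psoc p : P p -> exists s j, L j /\ a * p = s * t + a * j.
    move=> Pp; apply: tP; first by rewrite mulrC; apply: PmL.
    move=> x ux; exists (p * x); [exact: PmL | ring].
  have [s [j [Lj sE]]] := Psoc c' Pc'.
  have us : s \is a GRing.unit.
    apply: contraT => /mt[j' Lj' st]; exfalso; apply: nLc'.
    have -> : c' = j' + j; last exact: idealD.
    by apply: ra; rewrite mulrDr -st.
  have PE p : P p -> exists r i, L i /\ p = r * c' + i.
    move=> Pp; have [s' [j' [Lj' s'E]]] := Psoc p Pp.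
    exists (s' * s^-1), (j' - s' * s^-1 * j); split.
      by apply: idealB => //; apply: ideal_mull.
    have tE : t = s^-1 * (a * c' - a * j) by rewrite sE addrK mulKr.
    by apply: ra; rewrite s'E tE; ring.
  have HK := @ideal_mulP _ L (ideal_exp m k.+1) HL.
  (* The exponent [k + 1] provides a factor [y] in [m], which [c / b] takes to [y'] in [m]; so
     [c' y w = l y' w]. *)
  apply: (@reduction_sub _ _ _ k.+1) => //; first by move=> x /LP/Pm.
  move=> x /(reduction_succ HP e); apply: ideal_mul_sub => // p z /PE[r [i [Li ->]]] mz.
  rewrite mulrDl -mulrA; apply: (idealD HK); last exact: mem_ideal_mul.
  apply: (ideal_mull _ HK); move: z mz.
  apply: (ideal_mul_sub (ideal_colon c' HK)) => y w my mw /=.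
  have [y' uy' cy] := bc y my.
  have -> : c' * (y * w) = l * (y' * w).
    apply: rb; transitivity (b * c' * y * w); first by ring.
    rewrite -cl; transitivity (c * y * l * w); first by ring.
    by rewrite cy; ring.
  by apply: mem_ideal_mul => //; apply: mem_ideal_mul.
have [x0 [rx0 ux0 x0P]] : exists x : R, [/\ GRing.lreg x, x \isn't a GRing.unit &
    forall y : R, y \isn't a GRing.unit -> exists r, y = x * r].
  apply: (principal_max HR Hdim ra ua) => b c rb ub H.
  by apply: contrapT => nc; apply: allc; exists b, c.
have mexp i z : ideal_exp m i z -> exists r, z = x0 ^+ i * r.
  elim: i z => [|i IH] z; first by exists z; rewrite expr0 mul1r.
  apply: (ideal_mul_sub (K := [set z | exists r, z = x0 ^+ i.+1 * r])).
    split; first by exists 0; rewrite mulr0.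
    by move=> r _ _ [u ->] [v ->]; exists (r * u + v); ring.
  move=> u v /x0P[u' ->] /IH[v' ->]; exists (u' * v'); rewrite exprS; ring.
(* The power [x0 ^ (k + 1)] lies in [P m ^ k], hence in [x0 ^ k P]; cancelling puts [x0] in [P]. *)
have Px0 : P x0.
  have : ideal_exp m k.+1 (x0 ^+ k.+1) by exact: mem_ideal_exp.
  move=> /e; have : is_ideal (dilate (x0 ^+ k) P) by exact: dilateP.
  move=> HK /(ideal_mul_sub HK)[].
    by move=> p z Pp /mexp[r ->]; exists (p * r); [exact: ideal_mulr | ring].
  by move=> p Pp; rewrite exprSr => /(lregX rx0) ->.
have PE : P = m.
  apply/seteqP; split=> // y /x0P[r ->]; exact: ideal_mulr.
have LE : L = dilate x0 P.
  apply/seteqP; split=> [l Ll|_ [p Pp ->]]; last by rewrite mulrC; apply: PmL.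
  by apply: colon => // x /x0P[r ->]; exists (l * r); [exact: ideal_mulr | ring].
exists P; split; first by apply: (canonical_undilate rx0) => //; rewrite -LE.
by rewrite PE; split=> //; exists 0%N.
Qed.

End MainLemmas.

Theorem mainTheorem6 (R : localRingType)
    (R_CM : cohen_macaulay R)
    (R_dim1 : has_krull_dim R 1%N)
    (R_can : exists C : lmodType R, canonical_module C) :
  [<-> has_canonical_reduction R;
       has_canonical_reduction (@idealization R R^o);
       has_canonical_reduction (@idealization R (maxmodule R))].
Proof.
have [HR _] := R_CM; have [a [ra ua]] := CM_regular R_dim1 R_CM.
tfae.
- exact: (canonical_reduction_self HR R_dim1 ra ua).
- move=> /(canonical_reduction_of_self HR R_dim1 ra ua).
  exact: (canonical_reduction_max HR R_dim1 ra ua).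
- exact: (canonical_reduction_of_max HR R_dim1 ra ua).
Qed.
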